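(* Let $\alpha,\beta\in L^\infty$, and let $K$ be a compact operator on $L^2$. Then $\|S_{\alpha,\beta}-K\|\ge\frac1{\sqrt2}\|S_{\alpha,\beta}\|$. Moreover, the constant $\frac1{\sqrt2}$ is the maximum one, i.e. it is the largest constant $c$ such that $\|S_{\alpha,\beta}-K\|\ge c\,\|S_{\alpha,\beta}\|$ holds for all $\alpha,\beta\in L^\infty$ and all compact operators $K$ on $L^2$.
   Context: $S^1=\{z\in\mathbb{C}:|z|=1\}$ carries normalized Lebesgue measure; $L^2=L^2(S^1)$, $L^\infty=L^\infty(S^1)$ (complex-valued functions). $H^2$ is the Hardy space of all $f\in L^2$ whose negative Fourier coefficients vanish, and $H^{2\bot}$ is its orthogonal complement in $L^2$. $P$ and $Q=I-P$ are the orthogonal projections of $L^2$ onto $H^2$ and $H^{2\bot}$. For $\alpha,\beta\in L^\infty$, the operator $S_{\alpha,\beta}$ on $L^2$ is $S_{\alpha,\beta}f=\alpha Pf+\beta Qf$. Norms of operators are operator norms on $L^2$. *)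

(* Defs.v *)
From HB Require Import structures.
From mathcomp Require Import all_boot all_order all_algebra.
From mathcomp Require Import all_classical all_reals all_analysis.
From mathcomp Require Import measurable_realfun.
From mathcomp Require Export complex.

Set Implicit Arguments.
Unset Strict Implicit.
Unset Printing Implicit Defensive.

Import Order.TTheory GRing.Theory Num.Theory.
Import numFieldNormedType.Exports.
Import ComplexField.Normc.

Local Open Scope classical_set_scope.
Local Open Scope ring_scope.
Local Open Scope complex_scope.

Definition circle (R : realType) : Type := {z : R[i] | normc z == 1}.

Section Circle.
Context {R : realType}.

Lemma expi_subproof (t : R) :
  normc (cos (2 * pi * t) +i* sin (2 * pi * t)) == 1.
Proof. by rewrite /= cos2Dsin2 sqrtr1. Qed.

(* t |-> exp (2 i pi t) *)
Definition expi (t : measurableTypeR R) : circle R :=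
  exist (fun z : R[i] => normc z == 1) _ (expi_subproof t).

HB.instance Definition _ := SubChoice.on (circle R).
HB.instance Definition _ := isPointed.Build (circle R) (expi 0).

(* The Borel sets of S^1, obtained from those of R * R. *)
Definition circle_coord (z : circle R) : R * R :=
  (complex.Re (sval z), complex.Im (sval z)).

Definition circle_measurable : set (set (circle R)) :=
  g_sigma_algebra_preimage circle_coord.

Fact circle_measurable_set0 : circle_measurable set0.
Proof. exact: (@measurable0 _ (g_sigma_algebra_preimageType circle_coord)). Qed.

Fact circle_measurable_setC A : circle_measurable A -> circle_measurable (~` A).
Proof. exact: (@measurableC _ (g_sigma_algebra_preimageType circle_coord)). Qed.

Fact circle_measurable_bigcup (F : (set (circle R))^nat) :
  (forall i, circle_measurable (F i)) -> circle_measurable (\bigcup_i (F i)).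
Proof.
exact: (@bigcupT_measurable _ (g_sigma_algebra_preimageType circle_coord)).
Qed.

HB.instance Definition _ := @isMeasurable.Build default_measure_display
  (circle R) circle_measurable circle_measurable_set0 circle_measurable_setC
  circle_measurable_bigcup.

Lemma measurable_expi : measurable_fun [set: measurableTypeR R] expi.
Proof.
have mlin : measurable_fun [set: R] (fun t : R => 2 * pi * t).
  exact: mulrl_measurable.
have mcs : measurable_fun [set: R]
    (fun t : R => (cos (2 * pi * t), sin (2 * pi * t))).
  apply: measurable_fun_pair; apply: (measurableT_comp _ mlin).
  - apply: continuous_measurable_fun; exact: continuous_cos.
  - apply: continuous_measurable_fun; exact: continuous_sin.
by move=> _ _ [B mB <-]; rewrite !setTI -[X in measurable X]setTI; exact: mcs.
Qed.

HB.instance Definition _ :=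
  isMeasurableFun.Build _ _ _ _ expi measurable_expi.

(* Normalized Lebesgue measure on S^1: the image of the uniform probability
   on [0, 1] under t |-> exp (2 i pi t). *)
Definition circle_mu : set (circle R) -> \bar R :=
  distribution (uniform_prob (@ltr01 R)) expi.

HB.instance Definition _ := Probability.on circle_mu.

Implicit Types f g h : circle R -> R[i].

Definition cmeasurable f : Prop :=
  measurable_fun [set: circle R] (fun z => complex.Re (f z)) /\
  measurable_fun [set: circle R] (fun z => complex.Im (f z)).

Definition cmodulus f : circle R -> \bar R :=
  fun z => (normc (f z))%:E.

Definition cLnorm (p : \bar R) f : \bar R := 'N[circle_mu]_p[cmodulus f].

Definition cLfun (p : \bar R) f : Prop :=
  cmeasurable f /\ (cLnorm p f < +oo)%E.

(* Elements of L^2 and L^oo are represented by functions; equality in these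
   spaces is equality almost everywhere. *)
Definition L2 f : Prop := cLfun 2%:E f.
Definition Linfty f : Prop := cLfun +oo%E f.
Definition L2norm f : \bar R := cLnorm 2%:E f.

Definition cintegral f : R[i] :=
  (\int[circle_mu]_z complex.Re (f z)) +i* (\int[circle_mu]_z complex.Im (f z)).

Definition L2dot f g : R[i] := cintegral (fun z => f z * (g z)^*).

Definition fourier_coef f (n : int) : R[i] :=
  cintegral (fun z => f z * sval z ^ (- n)).

Definition H2 f : Prop := L2 f /\ forall n : int, n < 0 -> fourier_coef f n = 0.

Definition H2perp g : Prop := L2 g /\ forall h, H2 h -> L2dot g h = 0.

(* For f in L^2, the decomposition f = h + (f - h) with h in H^2 and f - h in
   its orthogonal complement exists, and h is unique almost everywhere; the
   default value 0 is only reached when f is not in L^2. *)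
Definition projP f : circle R -> R[i] :=
  xget (cst 0) [set h | H2 h /\ H2perp (f \- h)].

Definition projQ f : circle R -> R[i] := f \- projP f.

Definition Sop (alpha beta f : circle R -> R[i]) : circle R -> R[i] :=
  alpha \* projP f \+ beta \* projQ f.

Implicit Types T K : (circle R -> R[i]) -> (circle R -> R[i]).

(* T induces a linear operator on L^2 (functions up to a.e. equality); nothing
   is required of T outside L^2. *)
Definition L2_linear T : Prop :=
  [/\ forall f, L2 f -> L2 (T f),
      forall f g, L2 f -> L2 g ->
        f = g %[ae circle_mu] -> T f = T g %[ae circle_mu] &
      forall (a : R[i]) f g, L2 f -> L2 g ->
        T (fun z => a * f z + g z) = (fun z => a * T f z + T g z)
          %[ae circle_mu]].

(* Every bounded sequence has a subsequence whose image converges in L^2. *)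
Definition compact_operator K : Prop :=
  L2_linear K /\
  forall f_ : nat -> circle R -> R[i],
    (forall n, L2 (f_ n)) ->
    (exists M : R, forall n, (L2norm (f_ n) <= M%:E)%E) ->
    exists (phi : nat -> nat) (g : circle R -> R[i]),
      [/\ increasing_seq phi, L2 g &
          L2norm (K (f_ (phi n)) \- g) @[n --> \oo] --> 0%E].

Definition opnorm T : \bar R :=
  ereal_sup [set L2norm (T f) | f in [set f | L2 f /\ (L2norm f <= 1)%E]].

End Circle.

(* Main.v *)
(* The pointwise Cauchy-Schwarz inequality gives
   |alpha Pf + beta Qf|^2 <= (|alpha|^2 + |beta|^2) (|Pf|^2 + |Qf|^2), hence
   ||S|| <= sqrt 2 * max(||alpha||_oo, ||beta||_oo).  Conversely, if p is a
   trigonometric polynomial then S (z^n p) = alpha z^n p for n large.  Along a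
   subsequence K (z^n p) converges in norm, while sums of 2^k such functions
   with disjoint frequencies have norm only 2^(k/2) ||p||; so K is negligible on
   2^k z^n p minus such a sum, and ||alpha p|| <= ||S - K|| ||p||.  Density of
   trigonometric polynomials yields ||alpha||_oo <= ||S - K||, and negative
   shifts give the same bound for beta.

   The constant is attained for alpha = 1, beta = z and K f = <f, z^-1> 1:
   S (1 + z^-1) = 2 gives ||S|| >= sqrt 2, whereas S - K is the identity on H^2,
   kills z^-1, and shifts the rest of the complement of H^2 into that
   complement, so ||S - K|| <= 1. *)
Require Import Defs.
From mathcomp Require Import all_boot all_order all_algebra.
From mathcomp Require Import all_classical all_reals all_analysis.
From mathcomp Require Import complex.
From mathcomp Require Import measurable_realfun ess_sup_inf zify ring lra.
Set Implicit Arguments.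
Unset Strict Implicit.
Unset Printing Implicit Defensive.
Import Order.TTheory GRing.Theory Num.Theory.
Import numFieldNormedType.Exports.
Local Open Scope classical_set_scope.
Local Open Scope ring_scope.

(** The obstacle in the lower bound is that compactness only supplies some limit g of [K (z^n p)],
    about which nothing is known in advance. Comparing 2^k copies of one shift with a sum of 2^k
    different shifts eliminates g: the images of both are close to 2^k g, so they cancel, whereas
    orthogonality makes the sum too small to cancel the copies themselves. Passing from
    trigonometric polynomials to an essential bound amounts to testing on the indicator of {|f| >
    N}. Indicators of Borel sets are reached from an explicit polynomial step function, which
    handles the level sets of Re z and Im z, followed by a sigma-algebra argument. The extremal
    example is dictated by the equality case of Cauchy-Schwarz: Pf and Qf must have the same modulus
    and alpha Pf, beta Qf the same phase, which the choice Pf = 1, Qf = z^-1, beta = z achieves at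
    every point. *)

Local Notation normc := ComplexField.Normc.normc.
Local Notation normcM := ComplexField.Normc.normcM.
Local Notation Re := complex.Re.
Local Notation Im := complex.Im.

(** * Complex moduli *)

Section Modulus.
Context {R : realType}.
Local Open Scope complex_scope.
Implicit Types x y : R[i].

Lemma normc_ge0 x : 0 <= normc x.
Proof. by case: x => a b; rewrite /= sqrtr_ge0. Qed.

Lemma sqr_normcE x : normc x ^+ 2 = Re x ^+ 2 + Im x ^+ 2.
Proof. by case: x => a b /=; rewrite sqr_sqrtr// addr_ge0 ?sqr_ge0. Qed.

Lemma normc_conj x : normc x^* = normc x.
Proof. by case: x => a b /=; rewrite sqrrN. Qed.

Lemma normc_real (a : R) : 0 <= a -> normc a%:C = a.
Proof. by move=> a0; rewrite /= expr0n addr0 sqrtr_sqr ger0_norm. Qed.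

Lemma normcN x : normc (- x) = normc x.
Proof. by case: x => a b /=; rewrite !sqrrN. Qed.

Lemma ReM x y : Re (x * y) =
  Re x * Re y - Im x * Im y.
Proof. by case: x y => a b [c d]. Qed.

Lemma ImM x y : Im (x * y) =
  Re x * Im y + Im x * Re y.
Proof. by case: x y => a b [c d]. Qed.

Lemma ReD x y : Re (x + y) = Re x + Re y.
Proof. by case: x y => a b [c d]. Qed.

Lemma ImD x y : Im (x + y) = Im x + Im y.
Proof. by case: x y => a b [c d]. Qed.

Lemma Re_conj x : Re x^* = Re x.
Proof. by case: x. Qed.

Lemma Im_conj x : Im x^* = - Im x.
Proof. by case: x. Qed.

Lemma normRe_le x : `|Re x| <= normc x.
Proof.
by rewrite -ler_sqr ?nnegrE ?normc_ge0// sqr_normcE real_normK ?num_real ?lerDl ?sqr_ge0.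
Qed.

Lemma normIm_le x : `|Im x| <= normc x.
Proof.
by rewrite -ler_sqr ?nnegrE ?normc_ge0// sqr_normcE real_normK ?num_real ?lerDr ?sqr_ge0.
Qed.

Lemma sqr_normcD x y : normc (x + y) ^+ 2 =
  normc x ^+ 2 + normc y ^+ 2 + 2 * Re (x * y^*).
Proof. rewrite !sqr_normcE ReM Re_conj Im_conj ReD ImD; ring. Qed.

Lemma normcD x y : normc (x + y) <= normc x + normc y.
Proof.
rewrite -ler_sqr ?nnegrE ?addr_ge0 ?normc_ge0//.
rewrite sqr_normcD sqrrD [leRHS]addrAC lerD2l -[leRHS]mulr_natl ler_pM2l//.
rewrite (le_trans (ler_norm _))// (le_trans (normRe_le _))//.
by rewrite normcM normc_conj.
Qed.

Lemma normc_eq0 x : (normc x == 0) = (x == 0).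
Proof.
apply/eqP/eqP => [/ComplexField.Normc.eq0_normc//|->].
exact: ComplexField.Normc.normc0.
Qed.

Lemma sqr_normcM_le x y : normc x * normc y <= normc x ^+ 2 + normc y ^+ 2.
Proof.
have := sqr_ge0 (normc x - normc y); have := normc_ge0 x; have := normc_ge0 y.
nra.
Qed.

Lemma sqr_normc_comb_le (a b x y : R[i]) :
  normc (a * x + b * y) ^+ 2 <=
  (normc a ^+ 2 + normc b ^+ 2) * (normc x ^+ 2 + normc y ^+ 2).
Proof.
have h : normc (a * x + b * y) <= normc a * normc x + normc b * normc y.
  by rewrite -!normcM normcD.
have := normc_ge0 (a * x + b * y); have := normc_ge0 a; have := normc_ge0 b.
have := normc_ge0 x; have := normc_ge0 y.
(* Lagrange's identity: this square is exactly the gap in the Cauchy-Schwarz inequality for (A, B)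
   and (X, Y). *)
have := sqr_ge0 (normc a * normc y - normc b * normc x).
move: h; move: (normc (_ + _)) (normc a) (normc b) (normc x) (normc y) => u A B X Y.
move=> hh ? ? ? ? ? u0.
have w0 := le_trans u0 hh.
have : u ^+ 2 <= (A * X + B * Y) ^+ 2 by rewrite ler_sqr.
nra.
Qed.

End Modulus.

(** * Square-integrable functions on the circle *)

Section L2.
Context {R : realType}.
Local Open Scope complex_scope.
Local Notation C := R[i].
Local Notation mu := (@circle_mu R).
Implicit Types (f g h : circle R -> C) (a b c : C).

Lemma cmeasurable_cst c : cmeasurable (fun _ : circle R => c).
Proof. by split; exact: measurable_cst. Qed.

Lemma cmeasurableD f g : cmeasurable f -> cmeasurable g ->
  cmeasurable (fun z => f z + g z).
Proof.
move=> [f1 f2] [g1 g2]; split.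
- under eq_fun do rewrite ReD; exact: measurable_funD.
- under eq_fun do rewrite ImD; exact: measurable_funD.
Qed.

Lemma cmeasurableM f g : cmeasurable f -> cmeasurable g ->
  cmeasurable (fun z => f z * g z).
Proof.
move=> [f1 f2] [g1 g2]; split.
- under eq_fun do rewrite ReM.
  by apply: measurable_funB; exact: measurable_funM.
- under eq_fun do rewrite ImM.
  by apply: measurable_funD; exact: measurable_funM.
Qed.

Lemma cmeasurable_conj f : cmeasurable f -> cmeasurable (fun z => (f z)^*).
Proof.
move=> [f1 f2]; split.
- by under eq_fun do rewrite Re_conj.
- under eq_fun do rewrite Im_conj; exact: measurableT_comp.
Qed.

Lemma cmeasurable_sval : cmeasurable (fun z : circle R => sval z).
Proof.
have mc : measurable_fun [set: circle R] (@circle_coord R).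
  by move=> _ B mB; exists B.
by split; [apply: (measurableT_comp measurable_fst mc)|apply: (measurableT_comp measurable_snd mc)].
Qed.

Lemma normc_sval (z : circle R) : normc (sval z) = 1.
Proof. by apply/eqP; exact: (svalP z). Qed.

Lemma sval_neq0 (z : circle R) : sval z != 0.
Proof. by rewrite -normc_eq0 normc_sval oner_eq0. Qed.

Lemma conj_sval (z : circle R) : (sval z)^* = (sval z)^-1.
Proof.
have := normc_sval z; case: z => -[x y] /= _ /(congr1 (fun t => t ^+ 2)).
rewrite sqr_sqrtr ?addr_ge0 ?sqr_ge0// expr1n => xy1.
by apply/eqP; rewrite eq_complex /= xy1 !divr1 !eqxx.
Qed.

Lemma normc_exp (z : circle R) (n : int) : normc (sval z ^ n) = 1.
Proof.
have hn (m : nat) : normc (sval z ^+ m) = 1.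
  elim: m => [|m ih]; first by rewrite expr0 ComplexField.Normc.normc1.
  by rewrite exprS normcM ih normc_sval mulr1.
case: n => m; first exact: hn.
by rewrite NegzE -exprnN ComplexField.Normc.normcV hn invr1.
Qed.

Lemma conj_exp (z : circle R) (n : int) : (sval z ^ n)^* = sval z ^ (- n).
Proof.
have hn (m : nat) : (sval z ^+ m)^* = (sval z ^+ m)^-1.
  by rewrite rmorphXn /= conj_sval exprVn.
case: n => m; first by rewrite -exprnN hn.
by rewrite NegzE opprK -exprnN -hn conjcK.
Qed.

Lemma cmeasurable_exp (n : int) : cmeasurable (fun z : circle R => sval z ^ n).
Proof.
have hn (m : nat) : cmeasurable (fun z : circle R => sval z ^+ m).
  elim: m => [|m ih]; first by under eq_fun do rewrite expr0; exact: cmeasurable_cst.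
  under eq_fun do rewrite exprS; apply: cmeasurableM ih; exact: cmeasurable_sval.
case: n => m; first exact: hn.
rewrite (_ : (fun z => _) = (fun z : circle R => (sval z ^+ m.+1)^*)).
  exact: cmeasurable_conj.
by apply/funext => z; rewrite -[sval z ^+ _]/(sval z ^ m.+1) conj_exp.
Qed.

Lemma measurable_sqr_normc f : cmeasurable f ->
  measurable_fun [set: circle R] (fun z => normc (f z) ^+ 2).
Proof.
move=> [f1 f2]; under eq_fun do rewrite sqr_normcE.
by apply: measurable_funD; exact: measurable_funX.
Qed.

Lemma measurable_normc f : cmeasurable f ->
  measurable_fun [set: circle R] (fun z => normc (f z)).
Proof.
move=> mf; rewrite (_ : (fun z => _) = Num.sqrt \o (fun z => normc (f z) ^+ 2)).
  apply: measurableT_comp; last exact: measurable_sqr_normc.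
  by apply: continuous_measurable_fun; exact: sqrt_continuous.
by apply/funext => z /=; rewrite sqrtr_sqr ger0_norm// normc_ge0.
Qed.

(** Real-valued counterparts of [L2norm], so that ordinary field arithmetic applies. They are
    faithful on [L2] by [L2normE]; an infinite integral would be sent to 0. *)
Definition sqr_norm f : R := \int[mu]_z (normc (f z) ^+ 2).
Definition norm2 f : R := Num.sqrt (sqr_norm f).

Lemma sqr_norm_ge0 f : 0 <= sqr_norm f.
Proof. by apply: Rintegral_ge0 => z _; exact: sqr_ge0. Qed.

Lemma norm2_ge0 f : 0 <= norm2 f.
Proof. exact: sqrtr_ge0. Qed.

Lemma sqr_norm2 f : norm2 f ^+ 2 = sqr_norm f.
Proof. by rewrite sqr_sqrtr// sqr_norm_ge0. Qed.

Lemma sqr_L2norm f :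
  (L2norm f `^ 2%R = \int[mu]_z (normc (f z) ^+ 2)%:E)%E.
Proof.
rewrite /L2norm /cLnorm poweR_Lnorm//; apply: eq_integral => z _.
by rewrite /cmodulus /= ger0_norm ?normc_ge0// powR_mulrn// normc_ge0.
Qed.

Lemma L2normE0 f : (L2norm f = (\int[mu]_z (normc (f z) ^+ 2)%:E) `^ 2^-1)%E.
Proof.
rewrite -sqr_L2norm -poweRrM divff// poweRe1//; exact: Lnorm_ge0.
Qed.

Lemma L2P f : L2 f <->
  cmeasurable f /\ mu.-integrable setT (EFin \o (fun z => normc (f z) ^+ 2)).
Proof.
split=> -[mf hf]; split => //.
- apply/integrableP; split.
    by apply/measurable_EFinP; exact: measurable_sqr_normc.
  under eq_integral do rewrite /= ger0_norm ?sqr_ge0//.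
  by rewrite -sqr_L2norm poweR_lty.
- rewrite /L2norm -/(L2norm f) L2normE0 poweR_lty//.
  exact: integrable_lty.
Qed.

Lemma L2_cmeasurable f : L2 f -> cmeasurable f.
Proof. by case. Qed.

Lemma L2normE f : L2 f -> L2norm f = (norm2 f)%:E.
Proof.
move=> /L2P[mf hf]; rewrite L2normE0 /norm2 /sqr_norm -powR12_sqrt; last first.
  exact: sqr_norm_ge0.
rewrite -poweR_EFin fineK//.
exact: integrable_fin_num.
Qed.

End L2.

(** * Inner product and norm inequalities in L^2 *)

Section L2Algebra.
Context {R : realType}.
Local Open Scope complex_scope.
Local Notation C := R[i].
Local Notation mu := (@circle_mu R).
Implicit Types (f g h : circle R -> C) (a b c : C).

Definition cintegrable f : Prop :=
  mu.-integrable setT (EFin \o (fun z => Re (f z))) /\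
  mu.-integrable setT (EFin \o (fun z => Im (f z))).

Lemma cintegrable_le f (G : circle R -> R) : cmeasurable f ->
  (forall z, normc (f z) <= G z) -> mu.-integrable setT (EFin \o G) ->
  cintegrable f.
Proof.
move=> [mf1 mf2] fG iG; split; apply: le_integrable iG => //.
- exact/measurable_EFinP.
- move=> z _ /=; rewrite lee_fin (le_trans (normRe_le _))//.
  by rewrite (le_trans (fG z))// ler_norm.
- exact/measurable_EFinP.
- move=> z _ /=; rewrite lee_fin (le_trans (normIm_le _))//.
  by rewrite (le_trans (fG z))// ler_norm.
Qed.

Lemma cintegralD f g : cintegrable f -> cintegrable g ->
  cintegral (fun z => f z + g z) = cintegral f + cintegral g.
Proof.
move=> [f1 f2] [g1 g2]; rewrite /cintegral.
under eq_Rintegral do rewrite ReD.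
under [X in _ +i* X]eq_Rintegral do rewrite ImD.
by rewrite !RintegralD.
Qed.

Lemma cintegralZ c f : cintegrable f ->
  cintegral (fun z => c * f z) = c * cintegral f.
Proof.
move=> [f1 f2]; rewrite /cintegral.
under eq_Rintegral do rewrite ReM.
under [X in _ +i* X]eq_Rintegral do rewrite ImM.
have iZ (k : R) (u : circle R -> R) : mu.-integrable setT (EFin \o u) ->
    mu.-integrable setT (EFin \o (fun z => k * u z)).
  by move=> iu; exact: (integrableZl measurableT k iu).
rewrite RintegralB ?RintegralD//; [|exact: iZ..].
by rewrite !RintegralZl//; case: c.
Qed.

Lemma cintegral_conj f : cintegrable f ->
  cintegral (fun z => (f z)^*) = (cintegral f)^*.
Proof.
move=> [f1 f2]; rewrite /cintegral.
under eq_Rintegral do rewrite Re_conj.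
under [X in _ +i* X]eq_Rintegral do rewrite Im_conj -mulN1r.
by rewrite RintegralZl// mulN1r.
Qed.

Lemma L2_le_ae f g : cmeasurable f -> L2 g ->
  (\forall z \ae mu, normc (f z) <= normc (g z)) -> L2 f.
Proof.
move=> mf /L2P[mg /integrableP[_ ig]] fg; apply/L2P; split => //.
apply/integrableP; split.
  by apply/measurable_EFinP; exact: measurable_sqr_normc.
apply: le_lt_trans ig; apply: ae_ge0_le_integral => //.
- by apply/measurable_EFinP/measurableT_comp => //; exact: measurable_sqr_normc.
- by apply/measurable_EFinP/measurableT_comp => //; exact: measurable_sqr_normc.
- apply: filterS fg => z fg _ /=.
  by rewrite lee_fin !ger0_norm ?sqr_ge0// ler_sqr ?nnegrE ?normc_ge0.
Qed.

Lemma sqr_norm_le_ae f (G : circle R -> R) : L2 f ->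
  mu.-integrable setT (EFin \o G) -> (forall z, 0 <= G z) ->
  (\forall z \ae mu, normc (f z) ^+ 2 <= G z) ->
  sqr_norm f <= \int[mu]_z G z.
Proof.
move=> /L2P[mf if_] iG G0 fG; rewrite /sqr_norm /Rintegral fine_le//.
- exact: integrable_fin_num.
- exact: integrable_fin_num.
- apply: ae_ge0_le_integral => //.
  + by move=> z _; rewrite lee_fin sqr_ge0.
  + by case/integrableP : if_.
  + by move=> z _; rewrite lee_fin.
  + by case/integrableP : iG.
  + by apply: filterS fG => z fG _; rewrite lee_fin.
Qed.

Lemma norm2_le_ae f g : L2 f -> L2 g ->
  (\forall z \ae mu, normc (f z) <= normc (g z)) -> norm2 f <= norm2 g.
Proof.
move=> Lf /[dup] Lg /L2P[_ ig] fg; rewrite ler_sqrt ?sqr_norm_ge0//.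
apply: sqr_norm_le_ae => //; first by move=> z; exact: sqr_ge0.
by apply: filterS fg => z fg; rewrite ler_sqr ?nnegrE ?normc_ge0.
Qed.

Lemma norm2_ae f g : L2 f -> L2 g -> f = g %[ae mu] -> norm2 f = norm2 g.
Proof.
move=> Lf Lg fg; apply/eqP; rewrite eq_le !norm2_le_ae//.
- by apply: filterS fg => z /= /(_ I) ->.
- by apply: filterS fg => z /= /(_ I) ->.
Qed.

Lemma L2D f g : L2 f -> L2 g -> L2 (fun z => f z + g z).
Proof.
move=> /L2P[mf if_] /L2P[mg ig]; have mfg := cmeasurableD mf mg.
apply/L2P; split => //.
have i2 : mu.-integrable setT
    (EFin \o (fun z => 2 * (normc (f z) ^+ 2 + normc (g z) ^+ 2))).
  exact: (integrableZl measurableT 2 (integrableD measurableT if_ ig)).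
apply: le_integrable i2 => //.
  by apply/measurable_EFinP; exact: measurable_sqr_normc.
move=> z _ /=; rewrite lee_fin !ger0_norm ?sqr_ge0 ?mulr_ge0 ?addr_ge0 ?sqr_ge0//.
have := normcD (f z) (g z).
have := normc_ge0 (f z + g z).
have := sqr_ge0 (normc (f z) - normc (g z)).
move: (normc _) (normc (f z)) (normc (g z)) => u x y.
move=> s u0 h; have : 0 <= (x + y - u) * (x + y + u) by rewrite mulr_ge0//; lra.
nra.
Qed.

Lemma normc_mul_real (k : R) a : normc (k%:C * a) = `|k| * normc a.
Proof. by rewrite normcM /= expr0n addr0 sqrtr_sqr. Qed.

Lemma L2Z c f : L2 f -> L2 (fun z => c * f z).
Proof.
move=> /L2P[mf if_]; apply/L2P; split.
  by apply: cmeasurableM => //; exact: cmeasurable_cst.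
under [X in EFin \o X]eq_fun do rewrite normcM exprMn.
exact: (integrableZl measurableT (normc c ^+ 2) if_).
Qed.

Lemma norm2Z c f : L2 f -> norm2 (fun z => c * f z) = normc c * norm2 f.
Proof.
move=> /L2P[mf if_]; rewrite /norm2 /sqr_norm.
under eq_Rintegral do rewrite normcM exprMn.
by rewrite RintegralZl// sqrtrM ?sqr_ge0// sqrtr_sqr ger0_norm// normc_ge0.
Qed.

Lemma L2N f : L2 f -> L2 (fun z => - f z).
Proof. by move=> /(L2Z (-1)); under eq_fun do rewrite mulN1r. Qed.

Lemma norm2N f : norm2 (fun z => - f z) = norm2 f.
Proof. by rewrite /norm2 /sqr_norm; under eq_Rintegral do rewrite normcN. Qed.

Lemma L2B f g : L2 f -> L2 g -> L2 (fun z => f z - g z).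
Proof. by move=> Lf Lg; apply: L2D => //; exact: L2N. Qed.

Lemma L2_bounded f (M : R) : cmeasurable f -> (forall z, normc (f z) <= M) -> L2 f.
Proof.
move=> mf fM; have M0 : 0 <= M by rewrite (le_trans _ (fM (expi 0)))// normc_ge0.
apply: (@L2_le_ae _ (fun=> M%:C)) => //; last first.
  by apply: nearW => z; rewrite normc_real.
apply/L2P; split; first exact: cmeasurable_cst.
exact: finite_measure_integrable_cst.
Qed.

Lemma norm2_bounded f (M : R) : L2 f -> 0 <= M ->
  (\forall z \ae mu, normc (f z) <= M) -> norm2 f <= M.
Proof.
move=> Lf M0 fM; have LM : L2 (fun _ : circle R => M%:C).
  by apply: (@L2_bounded _ M); [exact: cmeasurable_cst|move=> z; rewrite normc_real].
rewrite (le_trans (norm2_le_ae Lf LM _))//.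
  by apply: filterS fM => z; rewrite normc_real.
rewrite /norm2 /sqr_norm Rintegral_cst//= probability_setT mulr1.
by rewrite expr0n addr0 !sqrtr_sqr normr_id ger0_norm.
Qed.

Lemma cintegrable_dot f g : L2 f -> L2 g -> cintegrable (fun z => f z * (g z)^*).
Proof.
move=> /L2P[mf if_] /L2P[mg ig].
apply: (cintegrable_le (G := fun z => normc (f z) ^+ 2 + normc (g z) ^+ 2)).
- by apply: cmeasurableM => //; exact: cmeasurable_conj.
- by move=> z; rewrite normcM normc_conj sqr_normcM_le.
- exact: (integrableD measurableT if_ ig).
Qed.

Lemma L2dotDl f g h : L2 f -> L2 g -> L2 h ->
  L2dot (fun z => f z + g z) h = L2dot f h + L2dot g h.
Proof.
move=> Lf Lg Lh; rewrite /L2dot -cintegralD; [|exact: cintegrable_dot..].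
by congr cintegral; apply/funext => z; rewrite mulrDl.
Qed.

Lemma L2dotZl c f h : L2 f -> L2 h ->
  L2dot (fun z => c * f z) h = c * L2dot f h.
Proof.
move=> Lf Lh; rewrite /L2dot -cintegralZ; last exact: cintegrable_dot.
by congr cintegral; apply/funext => z; rewrite mulrA.
Qed.

Lemma L2dot_sym f g : L2 f -> L2 g -> L2dot g f = (L2dot f g)^*.
Proof.
move=> Lf Lg; rewrite /L2dot -cintegral_conj; last exact: cintegrable_dot.
congr cintegral; apply/funext => z; move: (f z) (g z) => [a b] [c d].
by apply/eqP; rewrite eq_complex/=; apply/andP; split; apply/eqP; ring.
Qed.

Lemma L2dotBl f g h : L2 f -> L2 g -> L2 h ->
  L2dot (fun z => f z - g z) h = L2dot f h - L2dot g h.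
Proof.
move=> Lf Lg Lh; under [fun z => f z - _]eq_fun do rewrite -mulN1r.
by rewrite L2dotDl// ?L2dotZl ?mulN1r//; exact: L2Z.
Qed.

Lemma L2dotDr f g h : L2 f -> L2 g -> L2 h ->
  L2dot h (fun z => f z + g z) = L2dot h f + L2dot h g.
Proof.
move=> Lf Lg Lh; rewrite (L2dot_sym (L2D Lf Lg) Lh) L2dotDl//.
by rewrite (L2dot_sym Lf Lh) (L2dot_sym Lg Lh) rmorphD.
Qed.

Lemma L2dotZr c f h : L2 f -> L2 h ->
  L2dot h (fun z => c * f z) = c^* * L2dot h f.
Proof.
move=> Lf Lh; rewrite (L2dot_sym (L2Z c Lf) Lh) L2dotZl//.
by rewrite (L2dot_sym Lf Lh) rmorphM.
Qed.

Lemma L2dot_norm f : L2dot f f = (norm2 f ^+ 2)%:C.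
Proof.
rewrite sqr_norm2 /L2dot /cintegral; apply/eqP; rewrite eq_complex/=.
apply/andP; split; apply/eqP.
  by apply: eq_Rintegral => z _; rewrite sqr_normcE; case: (f z) => a b /=; ring.
rewrite -[RHS](@Rintegral_set0 _ _ _ mu (fun=> 0)) Rintegral_set0.
under eq_Rintegral => z _.
  rewrite (_ : Im _ = 0); last by case: (f z) => a b /=; ring.
  over.
by rewrite Rintegral_cst// mul0r.
Qed.

Lemma sqr_norm2D f g : L2 f -> L2 g ->
  norm2 (fun z => f z + g z) ^+ 2 =
  norm2 f ^+ 2 + norm2 g ^+ 2 + 2 * Re (L2dot f g).
Proof.
move=> /[dup] Lf /L2P[mf if_] /[dup] Lg /L2P[mg ig]; rewrite !sqr_norm2 /sqr_norm.
under eq_Rintegral do rewrite sqr_normcD.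
have [ifg _] := cintegrable_dot Lf Lg.
rewrite RintegralD//; last 2 first.
- exact: (integrableD measurableT if_ ig).
- exact: (integrableZl measurableT 2 ifg).
by rewrite RintegralD// RintegralZl.
Qed.

Lemma pythagoras f g : L2 f -> L2 g -> L2dot f g = 0 ->
  norm2 (fun z => f z + g z) ^+ 2 = norm2 f ^+ 2 + norm2 g ^+ 2.
Proof. by move=> Lf Lg fg; rewrite sqr_norm2D// fg /= mulr0 addr0. Qed.

(** Discriminant argument: ||t f + g||^2 is a nonnegative polynomial in the real variable t, of
    degree at most 2. *)
Lemma Re_dot_le f g : L2 f -> L2 g -> Re (L2dot f g) <= norm2 f * norm2 g.
Proof.
move=> Lf Lg; set d := Re _.
have h (t : R) : 0 <= t ^+ 2 * norm2 f ^+ 2 + norm2 g ^+ 2 + 2 * (t * d).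
  have Ltf := L2Z t%:C Lf.
  have := sqr_norm2D Ltf Lg; rewrite norm2Z// L2dotZl// => e.
  have := sqr_ge0 (norm2 (fun z => t%:C * f z + g z)); rewrite e exprMn.
  by rewrite sqr_normcE ReM [Re t%:C]/= [Im t%:C]/= expr0n addr0 mul0r subr0.
have := norm2_ge0 f; have := norm2_ge0 g; move: h.
move: (norm2 f) (norm2 g) d => a b d h b0 a0.
rewrite leNgt; apply/negP => abd.
have d0 : 0 < d by rewrite (le_lt_trans _ abd)// mulr_ge0.
have [a_gt0|a_le0] := ltP 0 a.
  have a2 : 0 < a ^+ 2 by rewrite exprn_gt0.
  (* The minimizer of the quadratic. *)
  have := h (- d / a ^+ 2).
  rewrite (_ : _ + _ = (b ^+ 2 * a ^+ 2 - d ^+ 2) / a ^+ 2); last first.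
    by field; rewrite gt_eqF.
  rewrite pmulr_lge0 ?invr_gt0// subr_ge0 -exprMn mulrC.
  by rewrite ler_sqr ?nnegrE ?mulr_ge0 ?(ltW d0)// leNgt abd.
(* The polynomial is now affine with slope 2 d > 0; the point chosen below gives it the value - b^2
   - 2 < 0. *)
have a00 : a = 0 by apply/eqP; rewrite eq_le a0 a_le0.
have := h (- (b ^+ 2 + 1) / d).
rewrite a00 (_ : _ + _ = - b ^+ 2 - 2); last by field; rewrite gt_eqF.
have := sqr_ge0 b; lra.
Qed.

Lemma norm2D_le f g : L2 f -> L2 g ->
  norm2 (fun z => f z + g z) <= norm2 f + norm2 g.
Proof.
move=> Lf Lg; rewrite -ler_sqr ?nnegrE ?addr_ge0 ?norm2_ge0//.
by rewrite sqr_norm2D// sqrrD; have := Re_dot_le Lf Lg; lra.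
Qed.

Lemma norm2B_le f g : L2 f -> L2 g ->
  norm2 (fun z => f z - g z) <= norm2 f + norm2 g.
Proof.
by move=> Lf Lg; rewrite (le_trans (norm2D_le Lf (L2N Lg)))// norm2N.
Qed.

End L2Algebra.

(** * Fourier analysis on the circle *)

Section Monomials.
Context {R : realType}.
Local Open Scope complex_scope.
Local Notation C := R[i].
Local Notation mu := (@circle_mu R).
Implicit Types (f g h : circle R -> C) (a b c : C).

(* Only nonnegative functions can be transferred along [uniform_prob], whence
   the detour through [1 + u]. *)
Lemma circle_Rintegral_FTC (u : circle R -> R) (V : R -> R) :
  measurable_fun [set: circle R] u -> (forall z, `|u z| <= 1) ->
  continuous (fun t : R => u (expi t)) ->
  (forall t : R, is_derive t (1 : R) V (u (expi t))) ->
  \int[mu]_z u z = V 1 - V 0.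
Proof.
move=> mu_ u1 cu dV.
have iu : mu.-integrable setT (EFin \o u).
  apply: (le_integrable measurableT _ _ (finite_measure_integrable_cst mu 1 measurableT)).
    exact/measurable_EFinP.
  by move=> z _ /=; rewrite lee_fin normr1.
have i1 := finite_measure_integrable_cst mu (1 : R) measurableT.
have dF (t : R) : is_derive t (1 : R) (id + V) (1 + u (expi t)).
  exact: is_deriveD.
suff : \int[mu]_z (1 + u z) = 1 + (V 1 - V 0).
  by rewrite (RintegralD measurableT i1 iu) Rintegral_cst//= probability_setT mul1r => /addrI ->.
rewrite /Rintegral [X in fine X](_ : _ = (\int[uniform_prob (@ltr01 R)]_t (1 + u (expi t))%:E)%E); last first.
  rewrite [LHS]ge0_integral_distribution//.
    by apply/measurable_EFinP; exact: measurable_funD.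
  by move=> z; rewrite lee_fin -lerBlDl sub0r; have := u1 z; rewrite ler_norml => /andP[].
rewrite integral_uniform//; last 2 first.
- apply/measurable_EFinP; apply: measurable_funD => //.
  exact: continuous_measurable_fun.
- by move=> z; rewrite lee_fin -lerBlDl sub0r; have := u1 (expi z); rewrite ler_norml => /andP[].
rewrite subr0 invr1 mul1e (@continuous_FTC2 _ _ (id + V))//=.
- by change ((1 + V 1) - (0 + V 0) = 1 + (V 1 - V 0)); ring.
- apply: continuous_subspaceT => t; apply: continuousD; last exact: cu.
  exact: cvg_cst.
- have cF : continuous (id + V : R -> R).
    move=> t; apply/differentiable_continuous/derivable1_diffP.
    exact: ex_derive.
  split => [t _||]; first exact: ex_derive.
  + exact/cvg_at_right_filter/cF.
  + exact/cvg_at_left_filter/cF.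
- by move=> t _; rewrite derive1E; exact: derive_val.
Qed.

Lemma expi_exp (t : R) (n : nat) :
  sval (expi t) ^+ n = cos (n%:R * (2 * pi * t)) +i* sin (n%:R * (2 * pi * t)).
Proof.
elim: n => [|n ih]; first by rewrite expr0 mul0r cos0 sin0.
have -> : n.+1%:R * (2 * pi * t) = n%:R * (2 * pi * t) + 2 * pi * t.
  by rewrite -[n.+1]addn1 natrD; ring.
rewrite exprS ih cosD sinD.
by apply/eqP; rewrite eq_complex /=; apply/andP; split; apply/eqP; ring.
Qed.

Lemma sval_expi1 : sval (expi (1 : R)) = 1.
Proof.
by rewrite /= mulr1 mulrC mulr_natr cos2pi sin2pi.
Qed.

Lemma sval_expi0 : sval (expi (0 : R)) = 1.
Proof. by rewrite /= mulr0 cos0 sin0. Qed.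

Lemma cintegral_exp_nat (n : nat) : (0 < n)%N ->
  cintegral (fun z : circle R => sval z ^+ n) = 0.
Proof.
move=> n0; have [m1 m2] := @cmeasurable_exp R n.
pose k : R := n%:R * (2 * pi).
have k0 : k != 0.
  by rewrite !mulf_neq0// ?pnatr_eq0 -?lt0n// gt_eqF// pi_gt0.
have e (t : R) : sval (expi t) ^+ n = cos (k * t) +i* sin (k * t).
  by rewrite expi_exp /k mulrA.
(* Periodicity: z^n = 1 at both t = 0 and t = 1, so each antiderivative takes equal values at the
   two ends. *)
have e1 := e 1; have e0 := e 0.
rewrite sval_expi1 expr1n in e1; rewrite sval_expi0 expr1n in e0.
case: e1 e0 => c1 s1 [c0 s0].
have dk (t : R) : is_derive t (1 : R) (fun t : R => k * t) k.
  by apply: is_derive_eq; rewrite -[RHS]mulr1.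
have ck : continuous (fun t : R => k * t) by move=> t; exact: mulrl_continuous.
apply/eqP; rewrite eq_complex; apply/andP; split; apply/eqP.
- rewrite [LHS](@circle_Rintegral_FTC _ (fun t => k^-1 * sin (k * t)))//.
  + by rewrite -s1 -s0 subrr.
  + by move=> z; rewrite (le_trans (normRe_le _))// (normc_exp z n).
  + under eq_fun do rewrite e; move=> t /=.
    by apply: continuous_comp; [exact: ck|exact: continuous_cos].
  + move=> t; rewrite e /=.
    have := is_derive1_comp (is_derive_sin (k * t)) (dk t).
    move=> /(@is_deriveZ _ _ _ _ k^-1); rewrite /GRing.scale /=.
    by rewrite mulrCA mulVf// mulr1.
- rewrite [LHS](@circle_Rintegral_FTC _ (fun t => - k^-1 * cos (k * t)))//.
  + by rewrite -c1 -c0 subrr.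
  + by move=> z; rewrite (le_trans (normIm_le _))// (normc_exp z n).
  + under eq_fun do rewrite e; move=> t /=.
    by apply: continuous_comp; [exact: ck|exact: continuous_sin].
  + move=> t; rewrite e /=.
    have := is_derive1_comp (is_derive_cos (k * t)) (dk t).
    move=> /(@is_deriveZ _ _ _ _ (- k^-1)); rewrite /GRing.scale /=.
    by rewrite (_ : - k^-1 * _ = sin (k * t))//; field.
Qed.

Lemma L2_exp (n : int) : L2 (fun z : circle R => sval z ^ n).
Proof.
by apply: (@L2_bounded _ _ 1); [exact: cmeasurable_exp|move=> z; rewrite normc_exp].
Qed.

Lemma cintegral_exp (n : int) :
  cintegral (fun z : circle R => sval z ^ n) = (n == 0)%:R.
Proof.
have L1 : L2 (fun _ : circle R => (1 : C)) by have := L2_exp 0.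
case: n => [[|n]|n]; last 2 first.
- exact: cintegral_exp_nat.
- have := cintegrable_dot (L2_exp n.+1) L1.
  rewrite (_ : (fun _ => _) = (fun z => sval z ^+ n.+1)); last first.
    by apply/funext => z; rewrite rmorph1 mulr1.
  move=> /cintegral_conj; rewrite cintegral_exp_nat// rmorph0 => h.
  rewrite [RHS](_ : _ = 0)// -h.
  congr cintegral; apply/funext => z.
  by rewrite -[sval z ^+ _]/(sval z ^ n.+1) conj_exp.
- rewrite /cintegral !Rintegral_cst// mul0r mul1r.
  by rewrite (_ : fine _ = 1)//; exact: (congr1 fine (probability_setT mu)).
Qed.

Lemma fourier_coefE f (n : int) : fourier_coef f n = L2dot f (fun z => sval z ^ n).
Proof.
congr cintegral; apply/funext => z; congr (_ * _).
exact: (esym (conj_exp z n)).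
Qed.

Lemma fourier_coef_exp (m n : int) :
  fourier_coef (fun z : circle R => sval z ^ m) n = (m == n)%:R.
Proof.
rewrite /fourier_coef -subr_eq0 -cintegral_exp; congr cintegral.
by apply/funext => z; rewrite expfzDr// sval_neq0.
Qed.

End Monomials.

(** * Trigonometric polynomials and the projection onto H^2 *)

Section TrigonometricPolynomials.
Context {R : realType}.
Local Open Scope complex_scope.
Local Notation C := R[i].
Local Notation mu := (@circle_mu R).
Implicit Types (f g h : circle R -> C) (a b c : C) (I J : set int).

(* Trigonometric polynomials with frequencies in I. *)
Inductive trig I : (circle R -> C) -> Prop :=
| trig0 : trig I (fun=> 0)
| trig_cons c n f : I n -> trig I f -> trig I (fun z => c * sval z ^ n + f z).

Lemma trig_subset I J f : I `<=` J -> trig I f -> trig J f.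
Proof.
move=> IJ; elim=> [|c n g /IJ Jn _ tg]; first exact: trig0.
exact: trig_cons.
Qed.

Lemma trig_exp I n : I n -> trig I (fun z => sval z ^ n).
Proof.
move=> In; have := trig_cons 1 In (trig0 I).
by under eq_fun do rewrite mul1r addr0.
Qed.

Lemma trigD I f g : trig I f -> trig I g -> trig I (fun z => f z + g z).
Proof.
move=> tf tg; elim: tf => [|c n h In _ th].
  by under eq_fun do rewrite add0r.
by under eq_fun do rewrite -addrA; exact: trig_cons.
Qed.

Lemma trigZ I c f : trig I f -> trig I (fun z => c * f z).
Proof.
elim=> [|a n h In _ th]; first by under eq_fun do rewrite mulr0; exact: trig0.
by under eq_fun do rewrite mulrDr mulrA; exact: trig_cons.
Qed.

Lemma trig_shift I J (k : int) f : (forall n, I n -> J (n + k)) -> trig I f ->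
  trig J (fun z => sval z ^ k * f z).
Proof.
move=> IJ; elim=> [|a n h In _ th].
  by under eq_fun do rewrite mulr0; exact: trig0.
under eq_fun => z.
  rewrite mulrDr mulrCA -expfzDr ?sval_neq0// addrC [k + _]addrC.
  over.
by under eq_fun do rewrite addrC; apply: trig_cons => //; exact: IJ.
Qed.

Lemma trigM f g : trig setT f -> trig setT g -> trig setT (fun z => f z * g z).
Proof.
move=> tf tg; elim: tf => [|a n h _ _ th].
  by under eq_fun do rewrite mul0r; exact: trig0.
under eq_fun do rewrite mulrDl -mulrA.
by apply: trigD => //; apply: trigZ; apply: trig_shift tg.
Qed.

(** The degree d tells how far a shift must go to move every frequency to one side of a given
    integer. *)
Lemma trig_finite I f : trig I f -> exists d : nat, trig [set n | `|n|%N <= d]%N f.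
Proof.
elim=> [|a n h In _ [d th]]; first by exists 0; exact: trig0.
exists (maxn `|n|%N d); apply: trig_cons; first by rewrite /= leq_maxl.
by apply: trig_subset th => m /= md; rewrite leq_max md orbT.
Qed.

Lemma trig_L2 I f : trig I f -> L2 f.
Proof.
elim=> [|a n h In _ th]; last by apply: L2D => //; apply: L2Z; exact: L2_exp.
apply: (@L2_bounded _ _ 0); first exact: cmeasurable_cst.
by move=> z; rewrite ComplexField.Normc.normc0.
Qed.

Lemma trig_bounded I f : trig I f -> exists M : R, forall z, normc (f z) <= M.
Proof.
elim=> [|a n h In _ [M hM]].
  by exists 0 => z; rewrite ComplexField.Normc.normc0.
exists (normc a + M) => z; rewrite (le_trans (normcD _ _))//.
by rewrite normcM normc_exp mulr1 lerD.
Qed.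

Lemma trig_dot0 I f h : trig I f -> L2 h ->
  (forall n, I n -> fourier_coef h n = 0) -> L2dot f h = 0.
Proof.
move=> tf Lh h0; elim: tf => [|a n g In tg ih].
  have L0 : L2 (fun=> 0 : C) := trig_L2 (trig0 setT).
  by have := L2dotZl 0 L0 Lh; under [fun z => _]eq_fun do rewrite mul0r; rewrite mul0r.
have Le := @L2_exp R n; have Lg := trig_L2 tg.
rewrite (L2dotDl (L2Z a Le) Lg Lh) (L2dotZl a Le Lh) ih addr0.
by rewrite (L2dot_sym Lh Le) -fourier_coefE h0// rmorph0 mulr0.
Qed.

Lemma trig_coef0 I f n : trig I f -> ~ I n -> fourier_coef f n = 0.
Proof.
move=> tf nIn; rewrite fourier_coefE; apply: (trig_dot0 tf (L2_exp n)) => m Im.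
by rewrite fourier_coef_exp; case: eqP => // e; case: nIn; rewrite e.
Qed.

Lemma trig_orth I J f g : trig I f -> trig J g -> (forall n, I n -> ~ J n) ->
  L2dot f g = 0.
Proof.
move=> tf tg IJ; apply: (trig_dot0 tf (trig_L2 tg)) => n In.
by apply: trig_coef0 tg _; exact: IJ.
Qed.

Lemma trig_H2 I f : I `<=` [set n | 0 <= n] -> trig I f -> H2 f.
Proof.
move=> I0 tf; split; first exact: trig_L2 tf.
by move=> n n0; apply: trig_coef0 tf _ => /I0 /=; rewrite leNgt n0.
Qed.

Lemma trig_H2perp I f : I `<=` [set n | n < 0] -> trig I f -> H2perp f.
Proof.
move=> I0 tf; split; first exact: trig_L2 tf.
by move=> h [Lh h0]; apply: trig_dot0 tf Lh _ => n /I0; exact: h0.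
Qed.

Lemma norm2_eq0 f : L2 f -> norm2 f = 0 -> f = (fun=> 0) %[ae mu].
Proof.
move=> Lf f0; have e := L2normE Lf; rewrite f0 in e.
have mf : measurable_fun setT (cmodulus f).
  by apply/measurable_EFinP/measurable_normc; exact: L2_cmeasurable.
have := Lnorm_eq0_eq0 mf (lte0n 2) e.
by apply: filterS => z /= /(_ I) [] /eqP; rewrite normc_eq0 => /eqP.
Qed.

Lemma H2B f g : H2 f -> H2 g -> H2 (fun z => f z - g z).
Proof.
move=> [Lf f0] [Lg g0]; split; first exact: L2B.
move=> n n0; rewrite fourier_coefE (L2dotBl Lf Lg (L2_exp n)) -!fourier_coefE.
by rewrite f0// g0// subrr.
Qed.

Lemma norm2_dot0 f : L2dot f f = 0 -> norm2 f = 0.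
Proof.
by rewrite L2dot_norm => -[] /eqP; rewrite expf_eq0/= => /eqP.
Qed.

Lemma H2_cst0 : H2 (fun _ : circle R => 0).
Proof. exact: (@trig_H2 set0 _ (@sub0set _ _) (trig0 _)). Qed.

Lemma H2perp_cst0 : H2perp (fun _ : circle R => 0).
Proof. exact: (@trig_H2perp set0 _ (@sub0set _ _) (trig0 _)). Qed.

Lemma projP_ex f : (exists h, H2 h /\ H2perp (f \- h)) ->
  H2 (projP f) /\ H2perp (f \- projP f).
Proof. by move=> /xgetPex; apply. Qed.

(** Two decompositions of f differ by an element of H^2 that is orthogonal to H^2, hence to
    itself. *)
Lemma projP_unique f h : H2 h -> H2perp (f \- h) -> projP f = h %[ae mu].
Proof.
move=> Hh Hfh; have [|Hp [Lq q0]] := @projP_ex f; first by exists h.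
have [Lfh fh0] := Hfh; have Hd := H2B Hp Hh; have Ld : L2 _ := Hd.1.
have : norm2 (fun z => projP f z - h z) = 0.
  apply: norm2_dot0; have := L2dotBl Lfh Lq Ld; rewrite fh0// q0// subrr => <-.
  by congr L2dot; apply/funext => z /=; ring.
by move/(norm2_eq0 Ld); apply: filterS => z /= /(_ I)/eqP; rewrite subr_eq0 => /eqP.
Qed.

Lemma projP_H2 f : H2 f -> projP f = f %[ae mu].
Proof.
move=> Hf; apply: projP_unique => //.
rewrite (_ : f \- f = fun=> 0); first exact: H2perp_cst0.
by apply/funext => z /=; rewrite subrr.
Qed.

Lemma projP_H2perp f : H2perp f -> projP f = (fun=> 0) %[ae mu].
Proof.
move=> Hf; apply: projP_unique; first exact: H2_cst0.
by rewrite (_ : f \- _ = f)//; apply/funext => z /=; rewrite subr0.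
Qed.

(* If no decomposition exists, [projP f] is the default value 0 and the
   conclusion holds trivially; hence L^2 need not be complete here. *)
Lemma projP_split f : L2 f -> [/\ H2 (projP f), L2 (projQ f) &
  (H2perp (projQ f) \/ projP f = fun=> 0)].
Proof.
move=> Lf; have [ex|nex] := pselect (exists h, H2 h /\ H2perp (f \- h)).
  by have [Hp Hq] := projP_ex ex; split => //; [case: Hq|left].
have p0 : projP f = fun=> 0.
  by rewrite /projP xgetPN// => h Hh; apply: nex; exists h.
split; [by rewrite p0; exact: H2_cst0| |by right].
by rewrite (_ : projQ f = f)//; apply/funext => z; rewrite /projQ p0 /= subr0.
Qed.

Lemma projP_pythagoras f : L2 f ->
  norm2 (projP f) ^+ 2 + norm2 (projQ f) ^+ 2 = norm2 f ^+ 2.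
Proof.
move=> /projP_split[Hp Lq pq]; rewrite addrC -pythagoras//; last 2 first.
- by case: Hp.
- case: pq => [[_ /(_ _ Hp)]//|p0]; rewrite L2dot_sym ?p0 //; last exact: (H2_cst0).1.
  rewrite (trig_dot0 (I := set0)) ?rmorph0//; exact: trig0.
by congr (norm2 _ ^+ 2); apply/funext => z; rewrite /projQ /= subrK.
Qed.

End TrigonometricPolynomials.

(** * Density of trigonometric polynomials *)

Section Threshold.
Context {R : realType}.
Implicit Types (t y : R).

Lemma bernoulli_ge t (n : nat) : 0 <= t -> 1 + n%:R * t <= (1 + t) ^+ n.
Proof.
move=> t0; elim: n => [|n ih]; first by rewrite mul0r addr0 expr0.
rewrite exprS (le_trans _ (ler_wpM2l _ ih)) ?addr_ge0// -[n.+1]addn1 natrD.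
have : 0 <= n%:R * t * t by rewrite !mulr_ge0.
nra.
Qed.

Lemma bernoulli_le t (n : nat) : 0 <= t <= 1 -> 1 - n%:R * t <= (1 - t) ^+ n.
Proof.
move=> /andP[t0 t1]; elim: n => [|n ih]; first by rewrite mul0r subr0 expr0.
rewrite exprS (le_trans _ (ler_wpM2l _ ih)) ?subr_ge0// -[n.+1]addn1 natrD.
have : 0 <= n%:R * t * t by rewrite !mulr_ge0.
nra.
Qed.

(** Write t^n = s^n s^n with s = sqrt t. Bernoulli for 1/s = 1 + h bounds n s^n by 1/h, and the
    remaining factor s^n tends to 0. *)
Lemma cvg_mul_expr t : 0 <= t < 1 -> (fun n : nat => n%:R * t ^+ n) @ \oo --> (0 : R).
Proof.
move=> /andP[t0 t1]; have [->|t_neq0] := eqVneq t 0.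
  apply: cvg_near_cst; near=> n; rewrite expr0n gtn_eqF ?mulr0//.
  by near: n; exact: nbhs_infty_gt.
pose s := Num.sqrt t; have s0 : 0 < s by rewrite sqrtr_gt0 lt_def t_neq0.
have s1 : s < 1 by rewrite -[ltRHS]sqrtr1 ltr_sqrt.
have st : t = s * s by rewrite -expr2 sqr_sqrtr.
pose h := s^-1 - 1; have h0 : 0 < h by rewrite subr_gt0 invf_gt1.
have le (n : nat) : n%:R * t ^+ n <= h^-1 * s ^+ n.
  rewrite st exprMn mulrA ler_pM2r ?exprn_gt0//.
  have h1 : 1 + h = s^-1 by rewrite /h addrC subrK.
  have := bernoulli_ge n (ltW h0); rewrite h1 exprVn => b.
  have sn : 0 < s ^+ n by rewrite exprn_gt0.
  rewrite -ler_pdivlMr// (le_trans _ (_ : h^-1 * (h * n%:R) <= _))//.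
    by rewrite mulKf ?gt_eqF.
  by rewrite ler_pM2l ?invr_gt0// mulrC (le_trans _ b)// lerDr.
apply: (@squeeze_cvgr _ _ _ _ (fun=> 0) (fun n => h^-1 * s ^+ n)).
- by apply: nearW => n; rewrite le mulr_ge0 ?exprn_ge0.
- exact: cvg_cst.
- rewrite -[X in _ --> X](mulr0 h^-1); apply: cvgMr.
  by apply: cvg_expr; rewrite gtr0_norm.
Unshelve. all: by end_near. Qed.

(** The exponent times y^n is n (2 y)^n, which tends to 0 for y < 1/2 and to infinity for y >= 1/2;
    the factor n decides the boundary case y = 1/2. *)
Definition threshold_poly (n : nat) y : R := (1 - y ^+ n) ^+ (n * 2 ^ n).

Lemma threshold_poly_itv n y : 0 <= y <= 1 -> 0 <= threshold_poly n y <= 1.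
Proof.
move=> /andP[y0 y1]; have yn : y ^+ n <= 1 by rewrite exprn_ile1.
by rewrite /threshold_poly exprn_ge0 ?subr_ge0// exprn_ile1 ?subr_ge0// gerBl exprn_ge0.
Qed.

(** With a = y^n and m the exponent, Bernoulli gives (1 - a)^m >= 1 - m a, which settles y < 1/2.
    For y >= 1/2, (1 - a)^m (1 + a)^m = (1 - a^2)^m <= 1 and (1 + a)^m >= 1 + m a >= n + 1. *)
Lemma cvg_threshold_poly y : 0 <= y <= 1 ->
  threshold_poly n y @[n --> \oo] --> ((y < 2^-1)%R%:R : R).
Proof.
move=> /andP[y0 y1].
have yn n : 0 <= y ^+ n <= 1 by rewrite exprn_ge0// exprn_ile1.
have E (n : nat) : (n * 2 ^ n)%N%:R * y ^+ n = n%:R * (2 * y) ^+ n.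
  by rewrite natrM natrX exprMn mulrA.
case: ltP => y2.
- apply: (@squeeze_cvgr _ _ _ _ (fun n => 1 - n%:R * (2 * y) ^+ n) (fun=> 1)).
  + apply: nearW => n; rewrite -E bernoulli_le//=.
    by have /andP[] := threshold_poly_itv n (introT andP (conj y0 y1)).
  + rewrite -[X in _ --> X]subr0; apply: cvgB; first exact: cvg_cst.
    by apply: cvg_mul_expr; rewrite mulr_ge0//=; lra.
  + exact: cvg_cst.
- apply: (@squeeze_cvgr _ _ _ _ (fun=> 0) harmonic); last 2 first.
  + exact: cvg_cst.
  + exact: cvg_harmonic.
  apply: nearW => n; have /andP[->/= _] := threshold_poly_itv n (introT andP (conj y0 y1)).
  have /andP[a0 a1] := yn n.
  rewrite -[leRHS]mul1r ler_pdivlMr//.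
  have b : n.+1%:R <= (1 + y ^+ n) ^+ (n * 2 ^ n).
    rewrite (le_trans _ (bernoulli_ge _ a0))// E -natr1 addrC lerD2l.
    by rewrite ler_peMr// exprn_ege1//; lra.
  rewrite (le_trans (ler_wpM2l _ b))//.
    by rewrite /threshold_poly exprn_ge0// subr_ge0.
  rewrite -exprMn exprn_ile1//; first by rewrite mulr_ge0 ?subr_ge0 ?addr_ge0.
  rewrite -subr_sqr expr1n gerBl; exact: sqr_ge0.
Qed.

End Threshold.

(** * The L^2 closure of trigonometric polynomials among bounded real functions *)

Section Density.
Context {R : realType}.
Local Open Scope complex_scope.
Local Notation C := R[i].
Local Notation mu := (@circle_mu R).
Implicit Types (f g h : circle R -> C) (u v : circle R -> R).

(** Boundedness is part of the definition because L^2 approximation alone does not pass to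
    products. *)
Definition trig_closure u : Prop :=
  [/\ measurable_fun setT u, exists M : R, forall z, `|u z| <= M &
      forall e : R, 0 < e ->
        exists2 p, trig setT p & norm2 (fun z => (u z)%:C - p z) <= e].

Lemma L2_real u (M : R) : measurable_fun setT u -> (forall z, `|u z| <= M) ->
  L2 (fun z => (u z)%:C).
Proof.
move=> mu_ uM; apply: (@L2_bounded _ _ M).
  by split => //=; exact: measurable_cst.
by move=> z; rewrite -[_%:C]mulr1 normc_mul_real ComplexField.Normc.normc1 mulr1.
Qed.

Lemma trig_closure_L2 u : trig_closure u -> L2 (fun z => (u z)%:C).
Proof. by move=> [mu_ [M uM] _]; exact: L2_real uM. Qed.

Lemma trig_closure_trig u : trig setT (fun z => (u z)%:C) -> trig_closure u.
Proof.
move=> tu; split.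
- by case: (L2_cmeasurable (trig_L2 tu)).
- have [M hM] := trig_bounded tu; exists M => z.
  by have := hM z; rewrite -[_%:C]mulr1 normc_mul_real ComplexField.Normc.normc1 mulr1.
- move=> e e0; exists (fun z => (u z)%:C) => //.
  rewrite (le_trans (norm2_bounded _ (lexx 0) _)) ?ltW//.
    by apply: L2B; exact: trig_L2 tu.
  by apply: nearW => z; rewrite subrr ComplexField.Normc.normc0.
Qed.

Lemma trig_closure_cst (k : R) : trig_closure (fun=> k).
Proof.
apply: trig_closure_trig; have := trigZ k%:C (@trig_exp R setT 0 I).
by under eq_fun do rewrite expr0z mulr1.
Qed.

Lemma trig_closureD u v : trig_closure u -> trig_closure v ->
  trig_closure (fun z => u z + v z).
Proof.
move=> /[dup] cu [mu_ [M uM] ua] /[dup] cv [mv [N vN] va]; split.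
- exact: measurable_funD.
- by exists (M + N) => z; rewrite (le_trans (ler_normD _ _))// lerD.
- move=> e e0; have e20 : 0 < e / 2 by rewrite divr_gt0.
  have [p tp pe] := ua _ e20; have [q tq qe] := va _ e20.
  exists (fun z => p z + q z); first exact: trigD.
  have -> : (fun z => (u z + v z)%:C - (p z + q z)) =
      (fun z => ((u z)%:C - p z) + ((v z)%:C - q z)).
    by apply/funext => z; rewrite rmorphD; ring.
  rewrite (le_trans (norm2D_le _ _))//.
  + by apply: L2B; [exact: trig_closure_L2|exact: trig_L2 tp].
  + by apply: L2B; [exact: trig_closure_L2|exact: trig_L2 tq].
  + by rewrite (le_trans (lerD pe qe))// -splitr.
Qed.

Lemma norm2_mul_le f g (M : R) : 0 <= M -> cmeasurable f -> L2 g ->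
  (\forall z \ae mu, normc (f z) <= M) ->
  L2 (fun z => f z * g z) /\ norm2 (fun z => f z * g z) <= M * norm2 g.
Proof.
move=> M0 mf Lg fM; have LMg := L2Z M%:C Lg.
have le : \forall z \ae mu, normc (f z * g z) <= normc (M%:C * g z).
  by apply: filterS fM => z fM; rewrite !normcM normc_real// ler_wpM2r// normc_ge0.
have Lfg : L2 (fun z => f z * g z).
  by apply: L2_le_ae LMg le; apply: cmeasurableM => //; exact: L2_cmeasurable.
by split => //; rewrite -[X in X * _](normc_real M0) -norm2Z// norm2_le_ae.
Qed.

Lemma trig_closureM u v : trig_closure u -> trig_closure v ->
  trig_closure (fun z => u z * v z).
Proof.
move=> /[dup] cu [mu_ [M uM] ua] /[dup] cv [mv [N vN] va]; split.
- exact: measurable_funM.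
- by exists (M * N) => z; rewrite normrM ler_pM.
- move=> e e0.
  have N0 : 0 <= N by rewrite (le_trans _ (vN (expi 0))).
  have d0 : 0 < e / 2 / (N + 1) by rewrite !divr_gt0// ltr_wpDl.
  have [p tp pe] := ua _ d0; have [P pP] := trig_bounded tp.
  have P0 : 0 <= P by rewrite (le_trans _ (pP (expi 0)))// normc_ge0.
  (* The error of q will be multiplied by p, so its tolerance depends on the bound P and q is chosen
     after p. Adding 1 keeps the denominators positive. *)
  have d'0 : 0 < e / 2 / (P + 1) by rewrite !divr_gt0// ltr_wpDl.
  have [q tq qe] := va _ d'0.
  exists (fun z => p z * q z); first exact: trigM.
  have -> : (fun z => (u z * v z)%:C - p z * q z) =
      (fun z => (v z)%:C * ((u z)%:C - p z) + p z * ((v z)%:C - q z)).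
    by apply/funext => z; rewrite rmorphM; ring.
  have Lup : L2 (fun z => (u z)%:C - p z).
    by apply: L2B; [exact: trig_closure_L2|exact: trig_L2 tp].
  have Lvq : L2 (fun z => (v z)%:C - q z).
    by apply: L2B; [exact: trig_closure_L2|exact: trig_L2 tq].
  have [L1 le1] : L2 (fun z => (v z)%:C * ((u z)%:C - p z)) /\
      norm2 (fun z => (v z)%:C * ((u z)%:C - p z)) <= N * norm2 (fun z => (u z)%:C - p z).
    apply: (@norm2_mul_le (fun z => (v z)%:C) _ N) => //.
    apply: nearW => z.
    by rewrite -[_%:C]mulr1 normc_mul_real ComplexField.Normc.normc1 mulr1.
  have [L2_ le2] : L2 (fun z => p z * ((v z)%:C - q z)) /\
      norm2 (fun z => p z * ((v z)%:C - q z)) <= P * norm2 (fun z => (v z)%:C - q z).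
    apply: (@norm2_mul_le p _ P) => //; first exact: L2_cmeasurable (trig_L2 tp).
    exact: nearW.
  rewrite (le_trans (norm2D_le L1 L2_))// [leRHS]splitr lerD//.
  + rewrite (le_trans le1)// (le_trans (ler_wpM2l N0 pe))//.
    by rewrite mulrA ler_pdivrMr ?ltr_wpDl// mulrC ler_pM2l ?divr_gt0// lerDl.
  + rewrite (le_trans le2)// (le_trans (ler_wpM2l P0 qe))//.
    by rewrite mulrA ler_pdivrMr ?ltr_wpDl// mulrC ler_pM2l ?divr_gt0// lerDl.
Qed.

Lemma trig_closureX u (n : nat) : trig_closure u -> trig_closure (fun z => u z ^+ n).
Proof.
move=> cu; elim: n => [|n ih].
  by under eq_fun do rewrite expr0; exact: trig_closure_cst.
by under eq_fun do rewrite exprS; exact: trig_closureM.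
Qed.

Lemma trig_closure_1B u : trig_closure u -> trig_closure (fun z => 1 - u z).
Proof.
move=> cu; under eq_fun do rewrite -mulN1r.
by apply: trig_closureD; [|apply: trig_closureM => //]; exact: trig_closure_cst.
Qed.

Lemma norm2_real u : norm2 (fun z => (u z)%:C) = Num.sqrt (\int[mu]_z (u z ^+ 2)).
Proof.
congr Num.sqrt; apply: eq_Rintegral => z _.
by rewrite sqr_normcE /= expr0n addr0.
Qed.

(** The uniform bounds allow dominated convergence for (u_n - v)^2, so a pointwise limit is also an
    L^2 limit. This is how discontinuous functions enter the closure. *)
Lemma trig_closure_lim (u_ : nat -> circle R -> R) v :
  (forall n, trig_closure (u_ n)) -> (forall n z, 0 <= u_ n z <= 1) ->
  (forall z, u_ n z @[n --> \oo] --> v z) -> trig_closure v.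
Proof.
move=> cu u01 uv.
have v01 z : 0 <= v z <= 1.
  have := uv z => uvz; apply/andP; split.
  - by apply: (cvgr_to_ge uvz); apply: nearW => n; case/andP: (u01 n z).
  - by apply: (cvgr_to_le uvz); apply: nearW => n; case/andP: (u01 n z).
have mv : measurable_fun setT v.
  apply: (@measurable_fun_cvg _ _ _ setT u_) => [n|z _]; last exact: uv.
  by case: (cu n).
have vb z : `|v z| <= 1 by case/andP: (v01 z) => a b; rewrite ger0_norm.
have Lv := L2_real mv vb.
split => //; first by exists 1.
move=> e e0; have e20 : 0 < e / 2 by rewrite divr_gt0.
have cv : (\int[mu]_z ((u_ n z - v z) ^+ 2)%:E)%E @[n --> \oo] --> 0%E.
  rewrite -(@integral0 _ _ _ mu setT).
  have i1 := finite_measure_integrable_cst mu (1 : R) measurableT.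
  apply: (@dominated_cvg _ _ _ mu setT measurableT _ _ (EFin \o cst 1)) => //.
  - move=> n; apply/measurable_EFinP; apply: measurable_funX.
    by apply: measurable_funB => //; case: (cu n).
  - move=> z _; apply: cvg_EFin; first by apply: nearW.
    have d : u_ n z - v z @[n --> \oo] --> (0 : R).
      by rewrite -(subrr (v z)); apply: cvgB; [exact: uv|exact: cvg_cst].
    by rewrite -(mulr0 (0 : R)); exact: (cvgM d d).
  - move=> n z _; rewrite /= lee_fin ger0_norm ?sqr_ge0//.
    have /andP[] := u01 n z; have /andP[] := v01 z; nra.
move/fine_cvgP : cv => [_ /cvgrPdist_lt /(_ _ (exprn_gt0 2 e20))].
move=> [n _ /(_ n (leqnn n))]; rewrite sub0r normrN /= => hn.
have [mun [N uN] /(_ _ e20)[p tp pe]] := cu n.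
exists p => //.
have -> : (fun z => (v z)%:C - p z) =
    (fun z => ((u_ n z)%:C - p z) - (u_ n z - v z)%:C).
  by apply/funext => z; rewrite rmorphB; ring.
have uvb z : `|u_ n z - v z| <= 1.
  by have /andP[] := u01 n z; have /andP[] := v01 z; rewrite ler_norml; lra.
have Lu := trig_closure_L2 (cu n); have Lp := trig_L2 tp.
have Luv := L2_real (measurable_funB mun mv) uvb.
rewrite (le_trans (norm2B_le (L2B Lu Lp) Luv))// [leRHS]splitr lerD//.
rewrite norm2_real -[leRHS](ger0_norm (ltW e20)) -sqrtr_sqr ler_sqrt ?sqr_ge0//.
exact: le_trans (ler_norm _) (ltW hn).
Qed.

End Density.

(** * Indicators of Borel sets, and essential bounds for multipliers *)

Section EssentialBound.
Context {R : realType}.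
Local Open Scope complex_scope.
Local Notation C := R[i].
Local Notation mu := (@circle_mu R).
Implicit Types (f g h : circle R -> C) (u v : circle R -> R) (A : set (circle R)).

Local Notation D A := (trig_closure (\1_A : circle R -> R)).

Lemma trig_closure_setC A : D A -> D (~` A).
Proof.
move=> /trig_closure_1B; congr trig_closure; apply/funext => z.
by rewrite !indicE in_setC; case: (z \in A); rewrite ?subrr ?subr0.
Qed.

Lemma trig_closure_setI A B : D A -> D B -> D (A `&` B).
Proof.
move=> dA dB; have := trig_closureM dA dB; congr trig_closure.
by apply/funext => z; rewrite !indicE in_setI; case: (z \in A); case: (z \in B);
  rewrite ?(mulr0, mulr1).
Qed.

Lemma trig_closure_setU A B : D A -> D B -> D (A `|` B).
Proof.
move=> dA dB; rewrite -[A `|` B]setCK setCU.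
by apply/trig_closure_setC/trig_closure_setI; exact: trig_closure_setC.
Qed.

Lemma trig_closure_set0 : D set0.
Proof. by rewrite indic0; exact: trig_closure_cst. Qed.

Lemma trig_closure_bigcup (F : nat -> set (circle R)) :
  (forall n, D (F n)) -> D (\bigcup_n F n).
Proof.
move=> dF; pose G n := \big[setU/set0]_(i < n) F i.
apply: (@trig_closure_lim _ (fun n => \1_(G n) : circle R -> R)).
- elim=> [|n ih]; first by rewrite /G big_ord0; exact: trig_closure_set0.
  by rewrite /G big_ord_recr; exact: trig_closure_setU.
- by move=> n z; rewrite indicE; case: (z \in _); rewrite /= ?ler01 ?lexx.
- move=> z; apply: cvg_near_cst; have [[k _ Fk]|nF] := pselect ((\bigcup_n F n) z).
  + exists k.+1 => // n /= kn; rewrite !indicE !mem_set//; first by exists k.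
    by rewrite /G -bigcup_mkord; exists k.
  + apply: nearW => n; rewrite !indicE !memNset//.
    by rewrite /G -bigcup_mkord => -[i _ Fi]; apply: nF; exists i.
Qed.

(** The map [phi] is left general to serve both a real function u, with rays as generators, and
    [circle_coord], with rectangles as generators. *)
Lemma trig_closure_sigma_algebra (T : Type) (phi : circle R -> T) :
  sigma_algebra setT [set B : set T | D (phi @^-1` B)].
Proof.
split => [|B|F dF] /=.
- by rewrite preimage_set0; exact: trig_closure_set0.
- by rewrite setTD preimage_setC; exact: trig_closure_setC.
- by rewrite preimage_bigcup; exact: trig_closure_bigcup.
Qed.

Lemma trig_closure_lt u (x : R) : trig_closure u -> (forall z, `|u z| <= 1) ->
  D [set z | u z < x].
Proof.
(* Since |u - x| <= 1 + |x|, this slope k gives an affine rescaling of u into [0, 1] that moves the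
   level x to 1/2, the jump of the threshold polynomials. *)
move=> cu u1; pose k : R := (2 * (1 + `|x|))^-1.
have k0 : 0 < k by rewrite invr_gt0 mulr_gt0// ltr_pwDl.
pose y z := k * (u z + - x) + 2^-1.
have cy : trig_closure y.
  apply: trig_closureD; last exact: trig_closure_cst.
  apply: trig_closureM; first exact: trig_closure_cst.
  by apply: trig_closureD => //; exact: trig_closure_cst.
have y01 z : 0 <= y z <= 1.
  have : `|k * (u z - x)| <= 2^-1.
    rewrite normrM gtr0_norm// /k invfM -mulrA ler_piMr ?invr_ge0//.
    rewrite mulrC ler_pdivrMr ?ltr_pwDl// mul1r (le_trans (ler_normB _ _))//.
    by rewrite lerD.
  by rewrite ler_norml /y; lra.
have -> : (\1_[set z | u z < x] : circle R -> R) = (fun z => (y z < 2^-1)%R%:R).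
  apply/funext => z; rewrite indicE /y gtrDr pmulr_rlt0// subr_lt0.
  by congr (_%:R); apply: congr1; apply/idP/idP; rewrite inE.
apply: (@trig_closure_lim _ (fun n z => threshold_poly n (y z))) => [n|n z|z].
- by apply/trig_closureX/trig_closure_1B/trig_closureX.
- exact: threshold_poly_itv.
- exact: cvg_threshold_poly.
Qed.

Lemma trig_closure_preimage u (B : set R) : trig_closure u -> (forall z, `|u z| <= 1) ->
  measurable B -> D (u @^-1` B).
Proof.
move=> cu u1.
suff : @measurable _ R `<=` [set B | D (u @^-1` B)] by apply.
rewrite [measurable]RGenInftyO.measurableE.
apply: smallest_sub; first exact: trig_closure_sigma_algebra.
move=> _ [x ->] /=; rewrite (_ : _ @^-1` _ = [set z | u z < x]).
  exact: trig_closure_lt.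
by apply/seteqP; split => z /=; rewrite in_itv.
Qed.

Lemma trig_closure_Re : trig_closure (fun z : circle R => Re (sval z)).
Proof.
apply: trig_closure_trig.
have := trigZ ((2 : C)^-1) (trigD (@trig_exp R setT 1 I) (@trig_exp R setT (-1) I)).
congr trig; apply/funext => z; rewrite expr1z exprN1 -conj_sval.
apply: (mulfI (_ : (2 : C) != 0)); first by rewrite pnatr_eq0.
rewrite mulVKf ?pnatr_eq0//; case: (sval z) => a b.
apply/eqP; rewrite eq_complex/=; apply/andP; split; apply/eqP; ring.
Qed.

Lemma trig_closure_Im : trig_closure (fun z : circle R => Im (sval z)).
Proof.
apply: trig_closure_trig.
have := trigZ ((2 : C)^-1 * - 'i)
  (trigD (@trig_exp R setT 1 I) (trigZ (-1) (@trig_exp R setT (-1) I))).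
congr trig; apply/funext => z; rewrite expr1z exprN1 -conj_sval -mulrA.
apply: (mulfI (_ : (2 : C) != 0)); first by rewrite pnatr_eq0.
rewrite mulVKf ?pnatr_eq0//; case: (sval z) => a b.
apply/eqP; rewrite eq_complex/=; apply/andP; split; apply/eqP; ring.
Qed.

(** Borel sets of the circle are traces of Borel sets of the plane, which rectangles generate; the
    trace of a rectangle is a condition on Re z intersected with one on Im z. *)
Lemma trig_closure_measurable A : measurable A -> D A.
Proof.
move=> [B mB <-]; rewrite setTI.
suff : @measurable _ (R * R)%type `<=` [set B | D (@circle_coord R @^-1` B)] by apply.
rewrite measurable_prod_measurableType.
apply: smallest_sub; first exact: trig_closure_sigma_algebra.
move=> _ [X mX [Y mY <-]] /=.
rewrite (_ : _ @^-1` _ = (fun z => Re (sval z)) @^-1` X `&` (fun z => Im (sval z)) @^-1` Y)//.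
apply: trig_closure_setI; apply: trig_closure_preimage => //.
- exact: trig_closure_Re.
- by move=> z; rewrite (le_trans (normRe_le _))// normc_sval.
- exact: trig_closure_Im.
- by move=> z; rewrite (le_trans (normIm_le _))// normc_sval.
Qed.

Lemma Linfty_bound f : Linfty f -> exists2 M : R, 0 <= M &
  cLnorm +oo%E f = M%:E /\ \forall z \ae mu, normc (f z) <= M.
Proof.
have mu_gt0 : (0 < mu setT)%E.
  by rewrite (_ : mu setT = 1%E)//; exact: probability_setT.
move=> [mf]; rewrite /cLnorm unlock; case: ifPn => [_|/negP[]//] fy.
set s := ess_sup _ _ in fy *.
have s0 : (0 <= s)%E by apply: ess_sup_gee => //; apply: nearW => z /=.
have sf : s \is a fin_num by rewrite ge0_fin_numE.
exists (fine s); first exact: fine_ge0.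
split; first by rewrite fineK.
have := ess_sup_ge mu (abse \o cmodulus f); apply: filterS => z.
by rewrite -/s -(fineK sf) /cmodulus /= lee_fin ger0_norm// normc_ge0.
Qed.

(* Approximating the indicator of [|f| > N] reduces an operator bound on
   trigonometric polynomials to a pointwise one. *)
Lemma mul_trig_bound f (N : R) : Linfty f -> 0 <= N ->
  (forall p, trig setT p -> norm2 (fun z => f z * p z) <= N * norm2 p) ->
  \forall z \ae mu, normc (f z) <= N.
Proof.
move=> Lf N0 fp; have mf : cmeasurable f by case: Lf.
have [M M0 [_ fM]] := Linfty_bound Lf.
have mn := measurable_normc mf.
pose E := [set z | N < normc (f z)].
have mE : measurable E.
  rewrite (_ : E = setT `&` (fun z => normc (f z)) @^-1` `]N, +oo[%classic).
    by apply: mn => //; exact: measurable_itv.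
  by apply/seteqP; split => z /=; rewrite in_itv/= andbT => // -[].
have cE := trig_closure_measurable mE.
have LE := trig_closure_L2 cE.
have [LfE _] := norm2_mul_le M0 mf LE fM.
have fE : norm2 (fun z => f z * (\1_E z)%:C) <= N * norm2 (fun z => (\1_E z)%:C).
  rewrite leNgt; apply/negP; rewrite -subr_gt0; set d := _ - _ => d0.
  (* With a the error of p, replacing the indicator by p costs M a in the norm of the product and N
     a in the bound; this tolerance keeps the total at most d / 2, contradicting a gap of d. *)
  have [_ _ /(_ (d / 2 / (N + M + 1)))] := cE.
  have NM : 0 < N + M + 1 by rewrite ltr_wpDl// addr_ge0.
  rewrite !divr_gt0// => /(_ isT)[p tp pe]; have Lp := trig_L2 tp.
  have Ld := L2B LE Lp.
  have [Lfd led] := norm2_mul_le M0 mf Ld fM.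
  have [Lfp _] := norm2_mul_le M0 mf Lp fM.
  have := norm2D_le Lfd Lfp.
  rewrite (_ : (fun z => _ + _) = (fun z => f z * (\1_E z)%:C)); last first.
    by apply/funext => z; ring.
  have := norm2D_le (L2N Ld) LE; rewrite norm2N.
  rewrite (_ : (fun z => _ + _) = p); last by apply/funext => z; ring.
  have := fp _ tp; move: pe led; rewrite /d.
  set a := norm2 (fun z => _ - _); set b := norm2 (fun z => _ * (_ - _)).
  set b' := norm2 (fun z => f z * p z); set q := norm2 p.
  move=> ad bM b'q qa ab.
  have : a * (N + M + 1) <= d / 2 by rewrite -ler_pdivlMr.
  have a0 : 0 <= a by exact: norm2_ge0.
  have : N * q <= N * (a + norm2 (fun z => (\1_E z)%:C)) by rewrite ler_wpM2l.
  by move: d0; rewrite /d; nra.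
have /L2P[_ i1] := LfE; have /L2P[_ i2] := LE.
have : sqr_norm (fun z => f z * (\1_E z)%:C) <= N ^+ 2 * sqr_norm (fun z => (\1_E z)%:C).
  by rewrite -!sqr_norm2 -exprMn ler_sqr ?nnegrE ?mulr_ge0 ?norm2_ge0.
rewrite /sqr_norm -RintegralZl// -subr_le0 -RintegralB//; last first.
  exact: (integrableZl measurableT (N ^+ 2) i2).
(* G is (|f|^2 - N^2) on E and 0 elsewhere: nonnegative with integral at most 0, hence null almost
   everywhere, yet positive on E. So E is negligible. *)
pose G z : R := normc (f z * (\1_E z)%:C) ^+ 2 - N ^+ 2 * normc (\1_E z)%:C ^+ 2.
have iG : mu.-integrable setT (EFin \o G).
  exact: (integrableB measurableT i1 (integrableZl measurableT (N ^+ 2) i2)).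
have G0 z : 0 <= G z.
  rewrite /G normcM exprMn -mulrBl indicE; case: (boolP (z \in E)) => zE /=.
    rewrite mulr_ge0 ?sqr_ge0// subr_ge0 ler_sqr ?nnegrE ?normc_ge0//.
    by move: zE; rewrite inE => /ltW.
  by rewrite !expr0n addr0 sqrtr0 expr0n mulr0.
rewrite -/(G _) => G_le0.
have GI : (\int[mu]_z `|(G z)%:E| = 0)%E.
  under eq_integral do rewrite gee0_abs ?lee_fin//.
  have := integrable_fin_num measurableT iG => Gf.
  rewrite -(fineK Gf); congr (_%:E); apply/eqP; rewrite eq_le G_le0/=.
  exact: Rintegral_ge0.
have mG : measurable_fun setT (EFin \o G) by case/integrableP: iG.
have := (ae_eq_integral_abs mu measurableT mG).1 GI.
apply: filterS => z /= /(_ I) []; rewrite /G => Gz0.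
rewrite leNgt; apply/negP => Nf; move: Gz0.
rewrite indicE mem_set//= mulr1 !expr1n expr0n addr0 sqrtr1 expr1n mulr1.
move=> /eqP; rewrite gt_eqF// subr_gt0 ltr_sqr ?nnegrE ?normc_ge0//.
Qed.

End EssentialBound.

(** * Compact perturbations *)

Section EssentialLowerBound.
Context {R : realType}.
Local Open Scope complex_scope.
Local Notation C := R[i].
Local Notation mu := (@circle_mu R).
Implicit Types (f g h : circle R -> C).
Implicit Types (T K : (circle R -> C) -> (circle R -> C)).

Lemma L2_cst0 : L2 (fun _ : circle R => (0 : C)).
Proof. exact: trig_L2 (trig0 setT). Qed.

Lemma L2_linearD K f g : L2_linear K -> L2 f -> L2 g ->
  K (fun z => f z + g z) = (fun z => K f z + K g z) %[ae mu].
Proof.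
move=> [_ _ /(_ 1 f g)] + Lf Lg => /(_ Lf Lg).
under [X in K X]eq_fun do rewrite mul1r.
by under [X in _ = X %[ae mu]]eq_fun do rewrite mul1r.
Qed.

(** Almost everywhere, K 0 = K (0 + 0) = K 0 + K 0. *)
Lemma L2_linear0 K : L2_linear K -> K (fun=> 0) = (fun=> 0) %[ae mu].
Proof.
move=> /L2_linearD /(_ L2_cst0 L2_cst0).
rewrite (_ : (fun z : circle R => _ + _) = (fun=> 0)); last first.
  by apply/funext => z; rewrite addr0.
apply: filterS => z /= /(_ I) /eqP.
by rewrite -subr_eq0 opprD addrA subrr sub0r oppr_eq0 => /eqP.
Qed.

Lemma L2_linearZ K (c : C) f : L2_linear K -> L2 f ->
  K (fun z => c * f z) = (fun z => c * K f z) %[ae mu].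
Proof.
move=> lK Lf; have K0 := L2_linear0 lK.
have [_ _ /(_ c f (fun=> 0) Lf L2_cst0) h] := lK.
rewrite (_ : (fun z => c * f z) = (fun z => c * f z + (fun=> 0) z)); last first.
  by apply/funext => z; rewrite addr0.
by move: K0 h; apply: filterS2 => z /= /(_ I) -> /(_ I); rewrite addr0.
Qed.

Lemma increasing_seq_leq (phi : nat -> nat) (i : nat) :
  increasing_seq phi -> (i <= phi i)%N.
Proof.
move=> phi_incr; elim: i => [|i ih]//; rewrite (leq_ltn_trans ih)//.
by have := phi_incr i.+1 i; rewrite leEnat ltnn ltnNge => ->.
Qed.

Section Compact.
(** The sign s lets one argument treat both symbols: s = 1, J0 = 0 will give alpha on frequencies n
    >= 0, and s = -1, J0 = 1 will give beta on frequencies n <= -1. *)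
Variables (gamma : circle R -> C) (T K : (circle R -> C) -> circle R -> C).
Variables (s J0 : int) (N : R).
Hypothesis s1 : s = 1 \/ s = -1.
Hypothesis Lgamma : Linfty gamma.
Hypothesis TL2 : forall f, L2 f -> L2 (T f).
Hypothesis Tgamma : forall f, trig [set n | J0 <= s * n] f ->
  T f = (fun z => gamma z * f z) %[ae mu].
Hypothesis cK : compact_operator K.
Hypothesis N0 : 0 <= N.
Hypothesis TK : forall f, L2 f -> norm2 f <= 1 -> norm2 (fun z => T f z - K f z) <= N.

Let lK : L2_linear K. Proof. by case: cK. Qed.
Let KL2 f : L2 f -> L2 (K f). Proof. by move=> Lf; case: lK => + _ _; apply. Qed.

Let gamma_mul f : L2 f -> L2 (fun z => gamma z * f z).
Proof.
move=> Lf; have [M M0 [_ gM]] := Linfty_bound Lgamma.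
by have [mg _] := Lgamma; have [] := norm2_mul_le M0 mg Lf gM.
Qed.

Lemma multiplier_sub_compact_le f : trig [set n | J0 <= s * n] f ->
  norm2 (fun z => gamma z * f z - K f z) <= N * norm2 f.
Proof.
move=> tf; have Lf := trig_L2 tf; apply/ler_addgt0Pr => e e0.
(* Rescaling f by 1 / (||f|| + d) rather than 1 / ||f|| covers ||f|| = 0, and N d <= e absorbs the
   loss. *)
pose d := e / (N + 1); have N1 : 0 < N + 1 by rewrite ltr_wpDl.
have d0 : 0 < d by rewrite divr_gt0.
have fd0 : 0 < norm2 f + d by rewrite ltr_wpDl// norm2_ge0.
pose c := (norm2 f + d)^-1; have c0 : 0 < c by rewrite invr_gt0.
have Lcf := L2Z c%:C Lf; have Lgf := gamma_mul Lf.
have LgK := L2B Lgf (KL2 Lf).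
have cf1 : norm2 (fun z => c%:C * f z) <= 1.
  by rewrite norm2Z// normc_real ?(ltW c0)// /c mulrC ler_pdivrMr// mul1r lerDl ltW.
have := TK Lcf cf1.
rewrite (norm2_ae (g := fun z => c%:C * (gamma z * f z - K f z))); last 3 first.
- by apply: L2B; [exact: TL2|exact: KL2].
- exact: L2Z.
- have := L2_linearZ c%:C lK Lf; have := Tgamma (trigZ c%:C tf).
  apply: filterS2 => z /= /(_ I) -> /(_ I) -> _; ring.
rewrite norm2Z// normc_real ?(ltW c0)// /c mulrC ler_pdivrMr// => /le_trans; apply.
rewrite mulrDr lerD2l /d mulrA ler_pdivrMr// mulrC ler_pM2l//.
by rewrite lerDl.
Qed.

Lemma norm2_shift f (n : int) : norm2 (fun z => sval z ^ n * f z) = norm2 f.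
Proof.
congr Num.sqrt; apply: eq_Rintegral => z _.
by rewrite normcM normc_exp mul1r.
Qed.

(* Adding [2 ^ k] shifts of [p] with disjoint frequencies multiplies the norm
   by [2 ^ (k / 2)] only, while their images under [K] add up coherently. *)
Lemma coherent_sum (p g : circle R -> C) (phi : nat -> nat) (d i0 : nat) (e : R) :
  trig [set n | (`|n| <= d)%N] p -> increasing_seq phi -> L2 g ->
  (forall i, (i0 <= i)%N ->
    norm2 (fun z => K (fun z => sval z ^ (s * (phi i)%:Z) * p z) z - g z) <= e) ->
  forall (k : nat) (J : int), exists (L : int) v,
  [/\ trig [set n | J <= s * n <= L] v, norm2 v ^+ 2 = 2 ^+ k * norm2 p ^+ 2 &
      norm2 (fun z => K v z - (2 ^+ k)%:C * g z) <= 2 ^+ k * e].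
Proof.
move=> tp phi_incr Lg Ke; elim=> [|k ih] J.
- pose i := maxn i0 (`|J| + d); have phi_ge : (i <= phi i)%N := increasing_seq_leq i phi_incr.
  exists ((phi i)%:Z + d%:Z), (fun z => sval z ^ (s * (phi i)%:Z) * p z); split.
  + apply: trig_shift tp => n /= nd.
    have : (`|J| + d <= phi i)%N by rewrite (leq_trans _ phi_ge)// leq_maxr.
    by case: s1 => ->; lia.
  + by rewrite norm2_shift expr0 mul1r.
  + rewrite expr0 mul1r; under [X in norm2 X]eq_fun do rewrite mul1r.
    by apply: Ke; rewrite leq_maxl.
- have [L1 [v1 [t1 n1 K1]]] := ih J.
  (* Starting the second block above [L1] makes the two blocks orthogonal, so their squared norms
     add; each image is still close to the same 2^k g. *)
  have [L2_ [v2 [t2 n2 K2]]] := ih (Num.max J (L1 + 1)).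
  have Lv1 := trig_L2 t1; have Lv2 := trig_L2 t2.
  exists (Num.max L1 L2_), (fun z => v1 z + v2 z); split.
  + apply: trigD.
      by apply: trig_subset t1 => n /=; lia.
    by apply: trig_subset t2 => n /=; lia.
  + rewrite pythagoras//; first by rewrite n1 n2 [2 ^+ k.+1]exprS; ring.
    by apply: trig_orth t1 t2 _ => n /=; lia.
  + have LK1 := KL2 Lv1; have LK2 := KL2 Lv2.
    have LZ := L2Z (2 ^+ k)%:C Lg.
    rewrite (norm2_ae (g := fun z => (K v1 z - (2 ^+ k)%:C * g z) +
                                     (K v2 z - (2 ^+ k)%:C * g z))).
    * rewrite (le_trans (norm2D_le (L2B LK1 LZ) (L2B LK2 LZ)))//.
      by rewrite exprS -mulrA mulr2n mulrDl mul1r lerD.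
    * by apply: L2B; [apply: KL2; exact: L2D|exact: L2Z].
    * by apply: L2D; exact: L2B.
    * have := L2_linearD lK Lv1 Lv2; apply: filterS => z /= /(_ I) -> _.
      by rewrite exprS mulr2n mulrDl mul1r rmorphD; ring.
Qed.

Lemma compact_multiplier_bound p : trig setT p ->
  norm2 (fun z => gamma z * p z) <= N * norm2 p.
Proof.
move=> /trig_finite[d tp]; have Lp := trig_L2 tp.
pose u i z : C := sval z ^ (s * i%:Z) * p z.
have Lu i : L2 (u i).
  by apply: trig_L2 (trig_shift (J := setT) _ tp).
have [_ /(_ u Lu)] := cK; case.
  by exists (norm2 p) => n; rewrite L2normE// lee_fin norm2_shift.
move=> phi [g [phi_incr Lg]].
rewrite [X in X @ _](_ : _ = fun n => (norm2 (fun z => K (u (phi n)) z - g z))%:E).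
  2: by apply/funext => n; rewrite L2normE//; apply: L2B => //; exact: KL2.
move=> /fine_cvgP[_ /cvgrPdist_le Kphi].
have [A A0 [_ gA]] := Linfty_bound Lgamma; have [mg _] := Lgamma.
apply/ler_addgt0Pr => e e0; have e30 : 0 < e / 3 by rewrite divr_gt0.
have [i0 _ Ke] := Kphi _ e30.
have {}Ke i : (i0 <= i)%N -> norm2 (fun z => K (u (phi i)) z - g z) <= e / 3.
  by move=> /Ke /=; rewrite sub0r normrN ger0_norm// norm2_ge0.
have sum := coherent_sum tp phi_incr Lg Ke.
pose i := maxn i0 (`|J0| + d); pose j := phi i.
have tu : trig [set n | J0 <= s * n <= j%:Z + d%:Z] (u j).
  apply: trig_shift tp => n /= nd.
  have : (`|J0| + d <= j)%N by rewrite (leq_trans _ (increasing_seq_leq _ phi_incr))// leq_maxr.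
  by case: s1 => ->; lia.
have Kj : norm2 (fun z => K (u j) z - g z) <= e / 3 by apply: Ke; rewrite leq_maxl.
(* The final estimate has main terms of order r^2 and a remainder r (A + N) ||p||; this m makes the
   remainder at most r^2 e / 3. *)
pose m := Num.bound ((A + N) * norm2 p / (e / 3)); pose r : R := 2 ^+ m.
have r0 : 0 < r by rewrite exprn_gt0.
have mr : (A + N) * norm2 p <= r * (e / 3).
  rewrite -ler_pdivrMr// (le_trans (ltW (archi_boundP _)))//.
    by rewrite divr_ge0 ?(ltW e30)// mulr_ge0 ?addr_ge0 ?norm2_ge0.
  by rewrite /r -natrX ler_nat ltnW// ltn_expl.
(* The even exponent m + m gives r^2 shifts, whose sum has norm exactly r ||p||. *)
have [L [v [tv nv Kv]]] := sum (m + m)%N (Num.max J0 (j%:Z + d%:Z + 1)).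
have {}nv : norm2 v = r * norm2 p.
  apply/eqP; rewrite -(@eqrXn2 _ 2)// ?mulr_ge0 ?norm2_ge0 ?(ltW r0)//.
  by rewrite nv exprMn exprD -expr2.
rewrite exprD -/r in Kv.
have Luj := Lu j; have Lv := trig_L2 tv; have LKu := KL2 Luj; have LKv := KL2 Lv.
pose c : C := (r * r)%:C.
pose w z : C := c * u j z - v z.
have Lw : L2 w by apply: L2B => //; exact: L2Z.
have tw : trig [set n | J0 <= s * n] w.
  have := trigD (I := [set n | J0 <= s * n]) (trigZ c (trig_subset _ tu)) (trigZ (-1) (trig_subset _ tv)).
  rewrite (_ : (fun z => _ + _) = w); last by apply/funext => z; rewrite mulN1r.
  by apply => n /=; lia.
have c_norm : normc c = r * r by rewrite normc_real// mulr_ge0 ?(ltW r0).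
have nw : norm2 w <= r * r * norm2 p + r * norm2 p.
  by rewrite (le_trans (norm2B_le (L2Z c Luj) Lv))// norm2Z// c_norm norm2_shift nv.
(* The two contributions c g cancel, leaving two errors of size at most r^2 e / 3 each. *)
have Kw : K w = (fun z => c * (K (u j) z - g z) - (K v z - c * g z)) %[ae mu].
  have -> : w = (fun z => c * u j z + (-1) * v z) by apply/funext => z; rewrite mulN1r.
  have := L2_linearD lK (L2Z c Luj) (L2Z (-1) Lv).
  have := L2_linearZ c lK Luj; have := L2_linearZ (-1) lK Lv.
  apply: filterS3 => z /= /(_ I) h1 /(_ I) h2 /(_ I) -> _.
  by rewrite h1 h2; ring.
have nKw : norm2 (K w) <= r * r * (e / 3) + r * r * (e / 3).
  have L1 := L2Z c (L2B LKu Lg); have L2_ := L2B LKv (L2Z c Lg).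
  rewrite (norm2_ae (KL2 Lw) (L2B L1 L2_) Kw) (le_trans (norm2B_le L1 L2_))//.
  by rewrite lerD// norm2Z ?c_norm ?ler_pM2l ?mulr_gt0//; exact: L2B.
have := multiplier_sub_compact_le tw => gw.
have Lgw := gamma_mul Lw; have Lgu := gamma_mul Luj.
have [Lgv ngv] := norm2_mul_le A0 mg Lv gA.
have e1 : norm2 (fun z => gamma z * w z) <= N * norm2 w + norm2 (K w).
  have := norm2D_le (L2B Lgw (KL2 Lw)) (KL2 Lw).
  under [X in norm2 X <= _]eq_fun do rewrite subrK.
  by move=> /le_trans; apply; rewrite lerD2r.
have e2 : r * r * norm2 (fun z => gamma z * p z) <=
    norm2 (fun z => gamma z * w z) + norm2 (fun z => gamma z * v z).
  have := norm2D_le Lgw Lgv.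
  rewrite (_ : (fun z => _ + _) = (fun z => c * (sval z ^ (s * j%:Z) * (gamma z * p z)))).
    rewrite norm2Z ?norm2_shift ?c_norm//.
    by under eq_fun do rewrite mulrCA.
  by apply/funext => z; rewrite /w /u; ring.
have p0 := norm2_ge0 p.
rewrite nv in ngv.
(* Of the three thirds of e, two come from [nKw] and one from [mr]. *)
have e3 : r * r * norm2 (fun z => gamma z * p z) <= r * r * (N * norm2 p + e).
  have : r * ((A + N) * norm2 p) <= r * (r * (e / 3)) by rewrite ler_pM2l.
  have : N * norm2 w <= N * (r * r * norm2 p + r * norm2 p) by rewrite ler_wpM2l.
  lra.
by rewrite -(ler_pM2l (mulr_gt0 r0 r0)).
Qed.

End Compact.
End EssentialLowerBound.

(** * Operator norms and the lower bound for compact perturbations of [Sop] *)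

Section Toeplitz.
Context {R : realType}.
Local Open Scope complex_scope.
Local Notation C := R[i].
Local Notation mu := (@circle_mu R).
Implicit Types (f g h alpha beta : circle R -> C).
Implicit Types (T K : (circle R -> C) -> (circle R -> C)).

Lemma Linfty_mul alpha f : Linfty alpha -> L2 f -> L2 (fun z => alpha z * f z).
Proof.
move=> La Lf; have [A A0 [_ aA]] := Linfty_bound La.
by have [] := norm2_mul_le A0 La.1 Lf aA.
Qed.

Lemma Sop_L2 alpha beta f : Linfty alpha -> Linfty beta -> L2 f ->
  L2 (Sop alpha beta f).
Proof.
move=> La Lb /projP_split[[Lp _] Lq _].
exact: (L2D (Linfty_mul La Lp) (Linfty_mul Lb Lq)).
Qed.

Lemma norm2_Sop_le alpha beta f (N : R) : Linfty alpha -> Linfty beta -> 0 <= N ->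
  (\forall z \ae mu, normc (alpha z) <= N) -> (\forall z \ae mu, normc (beta z) <= N) ->
  L2 f -> norm2 (Sop alpha beta f) <= Num.sqrt 2 * N * norm2 f.
Proof.
move=> La Lb N0 aN bN Lf; have [[Lp _] Lq _] := projP_split Lf.
have LS := Sop_L2 La Lb Lf.
have s2 : Num.sqrt 2 ^+ 2 = 2 :> R by rewrite sqr_sqrtr.
rewrite -ler_sqr ?nnegrE ?mulr_ge0 ?norm2_ge0 ?sqrtr_ge0// !exprMn s2.
rewrite -(projP_pythagoras Lf) !sqr_norm2.
have /L2P[_ ip] := Lp; have /L2P[_ iq] := Lq.
have iD := integrableD measurableT ip iq.
rewrite -RintegralD// -RintegralZl//.
apply: sqr_norm_le_ae => //.
- exact: (integrableZl measurableT (2 * N ^+ 2) iD).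
- by move=> z; rewrite !mulr_ge0 ?addr_ge0 ?sqr_ge0.
- move: aN bN; apply: filterS2 => z aN bN.
  rewrite (le_trans (sqr_normc_comb_le _ _ _ _))// ler_wpM2r ?addr_ge0 ?sqr_ge0//.
  by rewrite mulr_natl mulr2n lerD// ler_sqr ?nnegrE ?normc_ge0.
Qed.

Lemma opnorm_ge0 T : (0 <= opnorm T)%E.
Proof.
apply: (@le_trans _ _ (L2norm (T (fun=> 0)))); first exact: Lnorm_ge0.
apply: ereal_sup_ubound; exists (fun=> 0) => //=; split; first exact: L2_cst0.
rewrite L2normE; last exact: L2_cst0.
rewrite lee_fin (@norm2_bounded _ _ 1)//; first exact: L2_cst0.
by apply: nearW => z; rewrite ComplexField.Normc.normc0.
Qed.

Lemma opnorm_le T (N : R) : (forall f, L2 f -> L2 (T f)) ->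
  (forall f, L2 f -> norm2 f <= 1 -> norm2 (T f) <= N) -> (opnorm T <= N%:E)%E.
Proof.
move=> TL TN; apply: ge_ereal_sup => _ [f [Lf f1] <-].
rewrite L2normE; last exact: TL.
by rewrite lee_fin TN//; move: f1; rewrite L2normE// lee_fin.
Qed.

Lemma le_opnorm T f : L2 f -> L2 (T f) -> norm2 f <= 1 ->
  ((norm2 (T f))%:E <= opnorm T)%E.
Proof.
move=> Lf LTf f1; rewrite -L2normE//; apply: ereal_sup_ubound.
by exists f => //; split => //; rewrite L2normE.
Qed.

Lemma Sop_essential_le alpha beta K (N : R) :
  Linfty alpha -> Linfty beta -> compact_operator K -> 0 <= N ->
  (opnorm (fun f => (Sop alpha beta f \- K f)%R) <= N%:E)%E ->
  (\forall z \ae mu, normc (alpha z) <= N) /\ (\forall z \ae mu, normc (beta z) <= N).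
Proof.
move=> La Lb cK N0 SK.
have SL f : L2 f -> L2 (Sop alpha beta f) by exact: Sop_L2.
have KL f : L2 f -> L2 (K f) by case: cK => -[+ _ _] _; exact.
have SKN f : L2 f -> norm2 f <= 1 -> norm2 (fun z => Sop alpha beta f z - K f z) <= N.
  move=> Lf f1; rewrite -lee_fin (le_trans _ SK)//.
  exact: (@le_opnorm (fun f => (Sop alpha beta f \- K f)%R) f Lf (L2B (SL f Lf) (KL f Lf)) f1).
split.
- apply: (mul_trig_bound La N0) => p tp.
  apply: (@compact_multiplier_bound _ alpha (Sop alpha beta) K 1 0) => //; first by left.
  move=> f tf; have Hf : H2 f by apply: trig_H2 tf => n /=; rewrite mul1r.
  have := projP_H2 Hf; apply: filterS => z /= /(_ I) e _.
  by rewrite /Sop /projQ /= e subrr mulr0 addr0.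
- apply: (mul_trig_bound Lb N0) => p tp.
  apply: (@compact_multiplier_bound _ beta (Sop alpha beta) K (-1) 1) => //; first by right.
  move=> f tf; have Hf : H2perp f by apply: trig_H2perp tf => n /=; lia.
  have := projP_H2perp Hf; apply: filterS => z /= /(_ I) e _.
  by rewrite /Sop /projQ /= e subr0 mulr0 add0r.
Qed.

Lemma Sop_essential_norm_ge alpha beta K :
  Linfty alpha -> Linfty beta -> compact_operator K ->
  (((Num.sqrt 2)^-1)%:E * opnorm (Sop alpha beta) <=
    opnorm (fun f => (Sop alpha beta f \- K f)%R))%E.
Proof.
move=> La Lb cK; have := opnorm_ge0 (fun f => (Sop alpha beta f \- K f)%R).
case E : (opnorm (fun f => _)) => [N| |]// N0; last exact: leey.
have s2 : 0 < Num.sqrt 2 :> R by rewrite sqrtr_gt0.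
have [|aN bN] := @Sop_essential_le alpha beta K N La Lb cK N0; first by rewrite E.
rewrite muleC lee_pdivrMr// -EFinM.
apply: opnorm_le => [f Lf|f Lf f1]; first exact: Sop_L2.
rewrite (le_trans (norm2_Sop_le La Lb N0 aN bN Lf))// mulrC.
by rewrite mulrC [N * _]mulrC ler_piMr// mulr_ge0// ltW.
Qed.

End Toeplitz.

(** * Sharpness of the constant *)

Section Sharpness.
Context {R : realType}.
Local Open Scope complex_scope.
Local Notation C := R[i].
Local Notation mu := (@circle_mu R).
Implicit Types (f g h : circle R -> C).

Lemma Linfty_bounded f (M : R) : cmeasurable f -> (forall z, normc (f z) <= M) ->
  Linfty f.
Proof.
move=> mf fM; split => //; rewrite /cLnorm unlock; case: ifPn => // _.
apply: (@le_lt_trans _ _ M%:E); last exact: ltry.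
apply/ess_supP; apply: nearW => z /=.
by rewrite lee_fin ger0_norm ?normc_ge0.
Qed.

Lemma norm2_cst (c : C) : norm2 (fun _ : circle R => c) = normc c.
Proof.
rewrite /norm2 /sqr_norm Rintegral_cst// (_ : fine _ = 1).
  by rewrite mulr1 sqrtr_sqr ger0_norm// normc_ge0.
exact: (congr1 fine (probability_setT mu)).
Qed.

Lemma L2_cst (c : C) : L2 (fun _ : circle R => c).
Proof. by apply: (@L2_bounded _ _ (normc c)) => //; exact: cmeasurable_cst. Qed.

Lemma norm2_exp (n : int) : norm2 (fun z : circle R => sval z ^ n) = 1.
Proof.
have := norm2_shift (fun _ : circle R => 1 : C) n.
under [X in norm2 X]eq_fun do rewrite mulr1.
by move=> ->; rewrite norm2_cst ComplexField.Normc.normc1.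
Qed.

Lemma L2dot_ae f g h : L2 f -> L2 g -> L2 h -> f = g %[ae mu] ->
  L2dot f h = L2dot g h.
Proof.
move=> Lf Lg Lh fg; have [f1 f2] := cintegrable_dot Lf Lh.
have [g1 g2] := cintegrable_dot Lg Lh.
rewrite /L2dot /cintegral /Rintegral; congr (fine _ +i* fine _).
- apply: ae_eq_integral => //; [by case/integrableP: f1|by case/integrableP: g1|].
  by apply: filterS fg => z /= /(_ I) ->.
- apply: ae_eq_integral => //; [by case/integrableP: f2|by case/integrableP: g2|].
  by apply: filterS fg => z /= /(_ I) ->.
Qed.

(** For c the inner product of f and g, the function c^* f has the real inner product |c|^2 with g,
    so the bound on real parts applies; then divide by |c|. *)
Lemma normc_dot_le f g : L2 f -> L2 g -> normc (L2dot f g) <= norm2 f * norm2 g.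
Proof.
move=> Lf Lg; set c := L2dot f g.
have := Re_dot_le (L2Z c^* Lf) Lg.
rewrite L2dotZl// -/c norm2Z// normc_conj ReM Re_conj Im_conj mulNr opprK.
rewrite -!expr2 -sqr_normcE expr2 -mulrA.
have := normc_ge0 c; rewrite le_eqVlt => /predU1P[<- _|c0].
  by rewrite mulr_ge0 ?norm2_ge0.
by rewrite ler_pM2l.
Qed.

Definition rank_one (e v : circle R -> C) f : circle R -> C :=
  fun z => L2dot f e * v z.

Lemma cvg_increasing_seq (u : nat -> R) (phi : nat -> nat) (l : R) :
  increasing_seq phi -> u @ \oo --> l -> (u \o phi) @ \oo --> l.
Proof.
move=> phi_incr; apply: cvg_comp => A [n _ nA]; exists n => // k /= nk.
by apply: nA => /=; rewrite (leq_trans nk)// increasing_seq_leq.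
Qed.

(** Images are scalar multiples of v with bounded coefficients, so Bolzano-Weierstrass is applied to
    the real parts and then, along that subsequence, to the imaginary parts. *)
Lemma rank_one_compact e v : L2 e -> L2 v -> compact_operator (rank_one e v).
Proof.
move=> Le Lv; split; first split.
- by move=> f _; exact: L2Z.
- move=> f g Lf Lg fg; rewrite /rank_one (L2dot_ae Lf Lg Le fg).
  exact: nearW.
- move=> a f g Lf Lg; apply: nearW => z _; rewrite /rank_one.
  by rewrite (L2dotDl (L2Z a Lf) Lg Le) (L2dotZl a Lf Le) mulrDl mulrA.
- move=> f_ Lf [M fM]; pose c n := L2dot (f_ n) e.
  have cM n : normc (c n) <= M * norm2 e.
    rewrite (le_trans (normc_dot_le (Lf n) Le))// ler_wpM2r ?norm2_ge0//.
    by rewrite -lee_fin -L2normE.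
  have bounded (u : nat -> R) : (forall n, `|u n| <= M * norm2 e) -> bounded_fun u.
    move=> uM; exists (M * norm2 e); split; first exact: num_real.
    by move=> x Mx n _ /=; exact: le_trans (uM n) (ltW Mx).
  have [|phi1 phi1_incr /cvg_ex[/= a ca]] := @bolzano_weierstrass _ (fun n => Re (c n)).
    by apply: bounded => n; rewrite (le_trans (normRe_le _)).
  have [|phi2 phi2_incr /cvg_ex[/= b cb]] :=
      @bolzano_weierstrass _ (fun n => Im (c (phi1 n))).
    by apply: bounded => n; rewrite (le_trans (normIm_le _)).
  have {}ca := cvg_increasing_seq phi2_incr ca.
  exists (phi1 \o phi2), (fun z => (a +i* b) * v z); split.
  + by move=> m n /=; rewrite phi1_incr -leEnat phi2_incr.
  + exact: L2Z.
  have -> : (fun n => L2norm (rank_one e v (f_ ((phi1 \o phi2) n)) \- fun z => (a +i* b) * v z)) =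
      (fun n => (normc (c (phi1 (phi2 n)) - (a +i* b)) * norm2 v)%:E).
    apply/funext => n; rewrite -norm2Z// -L2normE; last exact: L2Z.
    by congr L2norm; apply/funext => z /=; rewrite mulrBl.
  apply: cvg_EFin; first exact: nearW.
  rewrite -[X in _ --> X](mul0r (norm2 v)); apply: cvgMl.
  apply: (@squeeze_cvgr _ _ _ _ (fun=> 0)
    (fun n => `|Re (c (phi1 (phi2 n))) - a| + `|Im (c (phi1 (phi2 n))) - b|)).
  + apply: nearW => n; rewrite normc_ge0/=; move: (c (phi1 (phi2 n))) => [x y] /=.
    rewrite -[leRHS]ger0_norm ?addr_ge0// -sqrtr_sqr ler_wsqrtr//.
    rewrite [leRHS]sqrrD !real_normK ?num_real// [leRHS]addrAC lerDl.
    by rewrite mulrn_wge0// mulr_ge0.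
  + exact: cvg_cst.
  + rewrite -[X in _ --> X](addr0 (0 : R)); apply: cvgD.
    * by apply/norm_cvg0P; rewrite -(subrr a); apply: cvgB => //; exact: cvg_cst.
    * by apply/norm_cvg0P; rewrite -(subrr b); apply: cvgB => //; exact: cvg_cst.
Qed.

Local Notation one := (fun _ : circle R => 1 : C).
Local Notation zbar := (fun z : circle R => sval z ^ (-1)).
Local Notation S := (Sop one (fun z => sval z)).
Local Notation K := (rank_one zbar one).

Lemma Linfty_one : Linfty one.
Proof.
apply: (@Linfty_bounded _ 1); first exact: cmeasurable_cst.
by move=> z; rewrite ComplexField.Normc.normc1.
Qed.

Lemma Linfty_exp (n : int) : Linfty (fun z : circle R => sval z ^ n).
Proof.
by apply: (@Linfty_bounded _ 1); [exact: cmeasurable_exp|move=> z; rewrite normc_exp].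
Qed.

Lemma Linfty_sval : Linfty (fun z : circle R => sval z).
Proof. by have := Linfty_exp 1; under eq_fun do rewrite expr1z. Qed.

Lemma L2dot_zbar : L2dot zbar zbar = 1.
Proof. by rewrite L2dot_norm norm2_exp expr1n. Qed.

Lemma H2_coef h (n : int) : H2 h -> n < 0 -> L2dot h (fun z => sval z ^ n) = 0.
Proof. by move=> [_ h0] n0; rewrite -fourier_coefE h0. Qed.

(* The adjoint of multiplication by z maps H^2 into H^2 + C z^-1. *)
Lemma shift_H2perp g h : H2perp g -> L2dot g zbar = 0 -> H2 h ->
  L2dot (fun z => sval z * g z) h = 0.
Proof.
move=> [Lg g0] gz Hh; have Lh : L2 h by case: Hh.
pose h0 := fourier_coef h 0.
have Le := @L2_exp R (-1).
have Lzh : L2 (fun z => sval z ^ (-1) * h z).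
  by apply: Linfty_mul Lh; exact: Linfty_exp.
have -> : L2dot (fun z => sval z * g z) h = L2dot g (fun z => sval z ^ (-1) * h z).
  congr cintegral; apply/funext => z; have := conj_exp z (-1).
  rewrite opprK expr1z => ze.
  transitivity (g z * (sval z * (h z)^*)); first by rewrite mulrA [g z * _]mulrC.
  by congr (_ * _); rewrite -[in LHS]ze rmorphM.
have Lr : L2 (fun z => sval z ^ (-1) * h z - h0 * sval z ^ (-1)) := L2B Lzh (L2Z h0 Le).
(* The only negative frequency of z^-1 h is -1, with coefficient h0. Removing h0 z^-1 leaves an
   element of H^2, and g is orthogonal to both pieces. *)
have -> : (fun z => sval z ^ (-1) * h z) =
    (fun z => (sval z ^ (-1) * h z - h0 * sval z ^ (-1)) + h0 * sval z ^ (-1)).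
  by apply/funext => z; rewrite subrK.
rewrite (L2dotDr Lr (L2Z h0 Le) Lg) (L2dotZr h0 Le Lg) gz mulr0 addr0.
apply: g0; split => // n n0.
have Ln := @L2_exp R n.
rewrite fourier_coefE (L2dotBl Lzh (L2Z h0 Le) Ln) (L2dotZl h0 Le Ln) -!fourier_coefE.
rewrite fourier_coef_exp.
have -> : fourier_coef (fun z => sval z ^ (-1) * h z) n = fourier_coef h (n + 1).
  congr cintegral; apply/funext => z.
  by rewrite opprD addrC expfzDr ?sval_neq0//; ring.
have [n1|n1] := eqVneq n (-1); first by rewrite n1 mulr1 subrr.
have [_ ->] := Hh; last by move: n0 n1; lia.
by rewrite mulr0 subr0.
Qed.

(** Write Qf = v + k z^-1 with v orthogonal to z^-1. Then z Qf = z v + k and K f = k, so the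
    difference is Pf + z v. These terms are orthogonal, and ||z v|| = ||v|| <= ||Qf||. *)
Lemma Sop_sub_rank_one_le f : L2 f -> norm2 (fun z => S f z - K f z) <= norm2 f.
Proof.
move=> Lf; have [Hp Lq pq] := projP_split Lf; have Lp : L2 (projP f) by case: Hp.
have Le := @L2_exp R (-1).
pose k := L2dot f zbar.
have kq : L2dot (projQ f) zbar = k.
  by rewrite /projQ (L2dotBl Lf Lp Le) (H2_coef (n := -1) Hp)// subr0.
pose v z := projQ f z - k * sval z ^ (-1).
have Lv : L2 v := L2B Lq (L2Z k Le).
have ve : L2dot v zbar = 0.
  by rewrite (L2dotBl Lq (L2Z k Le) Le) (L2dotZl k Le Le) kq L2dot_zbar mulr1 subrr.
have Lzv : L2 (fun z => sval z * v z) := Linfty_mul Linfty_sval Lv.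
have zvp : L2dot (fun z => sval z * v z) (projP f) = 0.
  (* When [projP f] is the default value 0, the inner product vanishes outright. *)
  case: pq => [Hq|->]; last first.
    rewrite L2dot_sym//; last exact: L2_cst0.
    by rewrite (trig_dot0 (trig0 set0))// rmorph0.
  apply: shift_H2perp => //; split => // h Hh; have [_ hq0] := Hq.
  have Lh : L2 h by case: Hh.
  rewrite (L2dotBl Lq (L2Z k Le) Lh) (L2dotZl k Le Lh) hq0//.
  by rewrite (L2dot_sym Lh Le) (H2_coef (n := -1) Hh)// rmorph0 mulr0 subr0.
have -> : (fun z => S f z - K f z) = (fun z => sval z * v z + projP f z).
  apply/funext => z; rewrite /Sop /rank_one /v -/k /= exprN1.
  (* Reading the value 1 in K f as z z^-1 exhibits K f as z times the term removed from Qf. *)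
  rewrite -[X in _ - k * X](mulfV (sval_neq0 z)); ring.
rewrite -ler_sqr ?nnegrE ?norm2_ge0// pythagoras// -(projP_pythagoras Lf) addrC lerD2l.
have -> : norm2 (fun z => sval z * v z) = norm2 v.
  by have := norm2_shift v 1; under [X in norm2 X]eq_fun do rewrite expr1z.
have -> : projQ f = (fun z => v z + k * sval z ^ (-1)).
  by apply/funext => z; rewrite /v subrK.
rewrite pythagoras//; last 2 first.
- exact: L2Z.
- by rewrite (L2dotZr k Le Lv) ve mulr0.
by rewrite lerDl sqr_ge0.
Qed.

Lemma opnorm_Sop_ge : ((Num.sqrt 2)%:E <= opnorm S)%E.
Proof.
pose k : R := (Num.sqrt 2)^-1.
have s0 : 0 < Num.sqrt 2 :> R by rewrite sqrtr_gt0.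
have k0 : 0 < k by rewrite invr_gt0.
have s2 : Num.sqrt 2 ^+ 2 = 2 :> R by rewrite sqr_sqrtr.
have Le := @L2_exp R (-1).
(* The functions 1 and z^-1 are orthonormal, so the factor 1 / sqrt 2 normalizes their sum. The
   exponent 0 stays visible so that both terms are handled as monomials. *)
pose h z : C := k%:C * sval (z : circle R) ^ 0.
pose g z : C := k%:C * sval (z : circle R) ^ (-1).
have th : trig [set 0] h by apply: trigZ; exact: trig_exp.
have tg : trig [set -1] g by apply: trigZ; exact: trig_exp.
have Lh := trig_L2 th; have Lg := trig_L2 tg.
pose f z := h z + g z; have Lf : L2 f by exact: L2D.
have nf : norm2 f <= 1.
  rewrite -ler_sqr ?nnegrE ?norm2_ge0// pythagoras//; last first.
    by apply: trig_orth th tg _ => n /= ->.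
  rewrite /h /g !norm2Z ?norm2_exp ?mulr1 ?normc_real ?(ltW k0)//; [|exact: L2_exp..].
  have : k ^+ 2 = 2^-1 by rewrite /k exprVn s2.
  rewrite expr1n; lra.
have LS := Sop_L2 Linfty_one Linfty_sval Lf.
have Sf : S f = (fun=> (Num.sqrt 2)%:C) %[ae mu].
  have : projP f = h %[ae mu].
    apply: projP_unique.
      by apply: trig_H2 th => n /= ->.
    rewrite (_ : f \- h = g); last by apply/funext => z; rewrite /f /= addrC addKr.
    by apply: trig_H2perp tg => n /= ->.
  apply: filterS => z /= /(_ I) e _.
  rewrite /Sop /projQ /= e /f /h /g expr0z mulr1 mul1r addrAC subrr add0r.
  rewrite mulrCA exprN1 mulfV ?sval_neq0// mulr1 -rmorphD; congr (_%:C).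
  by rewrite /k; apply: (mulfI (lt0r_neq0 s0)); rewrite mulrDr mulfV ?gt_eqF// -expr2 s2.
apply: le_trans (le_opnorm Lf LS nf).
by rewrite (norm2_ae LS (L2_cst _) Sf) norm2_cst normc_real// ltW.
Qed.

End Sharpness.

Unset Implicit Arguments.

Theorem theorem7p2 (R : realType) :
  (forall (alpha beta : circle R -> R[i])
      (K : (circle R -> R[i]) -> (circle R -> R[i])),
    Linfty alpha -> Linfty beta -> compact_operator K ->
    (((Num.sqrt 2)^-1)%:E * opnorm (Sop alpha beta) <=
      opnorm (fun f => (Sop alpha beta f \- K f)%R))%E) /\
  (forall c : R,
    (forall (alpha beta : circle R -> R[i])
        (K : (circle R -> R[i]) -> (circle R -> R[i])),
      Linfty alpha -> Linfty beta -> compact_operator K ->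
      (c%:E * opnorm (Sop alpha beta) <=
        opnorm (fun f => (Sop alpha beta f \- K f)%R))%E) ->
    c <= (Num.sqrt 2)^-1).
Proof.
split=> [alpha beta K La Lb cK|c h]; first exact: Sop_essential_norm_ge.
have s0 : 0 < Num.sqrt 2 :> R by rewrite sqrtr_gt0.
have Le := @L2_exp R (-1); have L1 := @L2_cst R 1.
have cK := rank_one_compact Le L1.
have SK := h _ _ _ Linfty_one Linfty_sval cK.
have [c0|c0] := leP c 0; first by rewrite (le_trans c0)// invr_ge0 ltW.
(* For c > 0 the chain is c sqrt 2 <= c ||S|| <= ||S - K|| <= 1. *)
rewrite -[leRHS]mul1r ler_pdivlMr// -lee_fin EFinM.
apply: (@le_trans _ _ (c%:E * opnorm (Sop (fun=> 1%R) (fun z : circle R => sval z)))%E).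
  by rewrite lee_wpmul2l ?lee_fin ?(ltW c0)// opnorm_Sop_ge.
apply: (le_trans SK); apply: opnorm_le => [f Lf|f Lf f1].
  exact: L2B (Sop_L2 Linfty_one Linfty_sval Lf) (L2Z _ L1).
exact: le_trans (Sop_sub_rank_one_le Lf) f1.
Qed.
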